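(* Let $K=\mathbb{C}(x,y,z)$ and let $\Omega=P\,dy\wedge dz+Q\,dz\wedge dx+R\,dx\wedge dy$ with $P,Q,R\in K$. If there exists a Liouvillian first integral of $\Omega$, then (at least) one of the following holds. (I) There exist 1-forms $\omega,\alpha\in K'$ such that $$\omega\neq0,\qquad \omega\wedge\Omega=0,\qquad \alpha\wedge\omega=d\omega,\qquad d\alpha=0.$$ That is, $\omega$ is Darboux integrable over $K$, and $\Omega$ has a first integral of the form $\phi=\int\frac{\omega}{m}$ (i.e. $d\phi=\omega/m$) for some Darboux function $m=e^{\int\alpha}$ over $K$ (i.e. $dm/m=\alpha$). (II) There exists a 1-form $\beta\in K'$ such that $d\Omega=\beta\wedge\Omega$ and $d\beta=0$. So $\Omega$ admits an inverse Jacobi multiplier $m=e^{\int\beta}$ (i.e. $dm/m=\beta$) of Darboux type over $K$.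
   Context: $K=\mathbb{C}(x,y,z)$ is a differential field with the commuting derivations $\partial/\partial x,\partial/\partial y,\partial/\partial z$. A differential extension of $K$ is an extension field $L$ with commuting derivations extending those of $K$. The constants $C_L$ are the elements of $L$ annihilated by all the derivations. $L'$ denotes the space of 1-forms $a\,dx+b\,dy+c\,dz$ with $a,b,c\in L$ ($dx,dy,dz$ are formal basis elements; forms of higher degree likewise), with the usual wedge product and exterior derivative $d$. A differential extension $L\supset K$ is a Liouvillian extension if $C_L=C_K$ and there is a tower of differential fields $K=K_0\subset K_1\subset\cdots\subset K_m=L$ such that for each $i$ one of the following holds: (i) $K_{i+1}=K_i(t_i)$ with $t_i\ne0$ and $dt_i=\delta_i t_i$ for some $\delta_i\in K_i'$; (ii) $K_{i+1}=K_i(t_i)$ with $dt_i=\delta_i$ for some $\delta_i\in K_i'$; (iii) $K_{i+1}$ is a finite algebraic extension of $K_i$. A Liouvillian first integral of $\Omega$ is a non-constant element $\phi$ of some Liouvillian extension of $K$ with $d\phi\wedge\Omega=0$. A Darboux function over $K$ is a function of the form $\exp(g/f)\prod f_i^{a_i}$ (finite product) with $f,g,f_i\in\mathbb{C}[x,y,z]$, $f,f_i\ne0$, and $a_i\in\mathbb{C}$; its logarithmic differential is the 1-form $d(g/f)+\sum a_i\,df_i/f_i\in K'$. That $\omega$ is Darboux integrable over $K$ means that there is a Darboux function $m$ with $d(\omega/m)=0$. An inverse Jacobi multiplier of $\Omega$ is a nonzero function $m$ with $d(\Omega/m)=0$; nonzero constants are allowed as multipliers. *)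

(* Defs.v *)
From HB Require Import structures.
From mathcomp Require Import all_boot all_order all_algebra ring.
From mathcomp Require Import boolp classical_sets reals.
From mathcomp Require Import complex mpoly.

Set Implicit Arguments.
Unset Strict Implicit.
Unset Printing Implicit Defensive.

Import GRing.Theory.
Local Open Scope classical_set_scope.
Local Open Scope ring_scope.

(* The indices 0, 1, 2 of 'I_3 stand for x, y, z throughout. *)

HB.mixin Record Field_isDifferential L of GRing.Field L := {
  der : 'I_3 -> L -> L;
  derD : forall i, {morph der i : x y / x + y};
  derM : forall i x y, der i (x * y) = der i x * y + x * der i y;
  der_comm : forall i j x, der i (der j x) = der j (der i x)
}.

#[short(type="diffFieldType")]
HB.structure Definition DiffField := {L of GRing.Field L & Field_isDifferential L}.

Section FracIdentities.
Variables (K : fieldType) (a b c d a' b' c' d' : K).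
Hypotheses (b0 : b != 0) (d0 : d != 0).

Fact fracD_id :
  ((a' * d + a * d' + (c' * b + c * b')) * (b * d) -
   (a * d + c * b) * (b' * d + b * d')) / (b * d) ^+ 2 =
  (a' * b - a * b') / b ^+ 2 + (c' * d - c * d') / d ^+ 2.
Proof. by field; rewrite b0 d0. Qed.

Fact fracM_id :
  ((a' * c + a * c') * (b * d) - (a * c) * (b' * d + b * d')) / (b * d) ^+ 2 =
  (a' * b - a * b') / b ^+ 2 * (c / d) + a / b * ((c' * d - c * d') / d ^+ 2).
Proof. by field; rewrite b0 d0. Qed.
End FracIdentities.

Section FracDer.
Variables (A : idomainType) (D : A -> A).
Hypothesis DD : {morph D : x y / x + y}.
Hypothesis DM : forall x y, D (x * y) = D x * y + x * D y.
Local Notation "x %:F" := (@FracField.tofrac A x).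

Definition frac_der (x : {fraction A}) : {fraction A} :=
  let n := \n_(repr x) in let d := \d_(repr x) in
  (D n * d - n * D d)%:F / d%:F ^+ 2.

Lemma frac_reprE (x : {fraction A}) : x = (\n_(repr x))%:F / (\d_(repr x))%:F.
Proof.
have d0 : \d_(repr x) != 0 by case: (repr x).
have dF : (\d_(repr x))%:F != 0 by rewrite tofrac_eq0.
apply: (canRL (mulfK dF)).
rewrite -[x in LHS]reprK /FracField.tofrac; unlock.
rewrite [in LHS]/GRing.mul /= -!FracField.pi_mul.
apply/eqmodP; rewrite /= FracField.equivfE /FracField.mulf.
by rewrite !numden_Ratio ?reprK ?mulr1 ?oner_neq0 // mulrC.
Qed.

Lemma frac_derE (a b : A) : b != 0 ->
  frac_der (a%:F / b%:F) = (D a * b - a * D b)%:F / b%:F ^+ 2.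
Proof.
move=> b0; rewrite /frac_der; set x := a%:F / b%:F.
have := frac_reprE x; have : \d_(repr x) != 0 by case: (repr x).
move: (\n_(repr x)) (\d_(repr x)) => n d d0 xE.
have e : a * d = n * b.
  apply/eqP; rewrite -tofrac_eq !tofracM.
  by rewrite -eqr_div ?tofrac_eq0 // -xE.
have De : D a * d + a * D d = D n * b + n * D b by rewrite -!DM e.
apply/eqP; rewrite eqr_div ?expf_neq0 ?tofrac_eq0 //.
rewrite -!tofracXn -!tofracM tofrac_eq; apply/eqP.
have -> : (D a * b - a * D b) * d ^+ 2
        = (D a * d) * (b * d) - (a * d) * (D b * d) by ring.
have -> : D a * d = D n * b + n * D b - a * D d by rewrite -De addrK.
rewrite e; have -> : (D n * b + n * D b - a * D d) * (b * d) =
  D n * b * b * d + n * D b * b * d - (a * d) * D d * b by ring.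
by rewrite e; ring.
Qed.

Lemma fracP (x : {fraction A}) : exists a b, b != 0 /\ x = a%:F / b%:F.
Proof.
by exists (\n_(repr x)), (\d_(repr x)); split; [by case: (repr x)|exact: frac_reprE].
Qed.

Lemma frac_derD : {morph frac_der : x y / x + y}.
Proof.
move=> x y; have [a [b [b0 ->]]] := fracP x; have [c [d [d0 ->]]] := fracP y.
have bF : b%:F != 0 by rewrite tofrac_eq0.
have dF : d%:F != 0 by rewrite tofrac_eq0.
rewrite addf_div // -!tofracM -tofracD !frac_derE ?mulf_neq0 // !(DM, DD).
by rewrite !(tofracM, tofracB, tofracD) fracD_id.
Qed.

Lemma frac_derM x y : frac_der (x * y) = frac_der x * y + x * frac_der y.
Proof.
have [a [b [b0 ->]]] := fracP x; have [c [d [d0 ->]]] := fracP y.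
have bF : b%:F != 0 by rewrite tofrac_eq0.
have dF : d%:F != 0 by rewrite tofrac_eq0.
rewrite mulf_div -!tofracM !frac_derE ?mulf_neq0 // !(DM, DD).
by rewrite !(tofracM, tofracB, tofracD) fracM_id.
Qed.
End FracDer.

Section FracDerComm.
Variables (A : idomainType) (D E : A -> A).
Hypothesis DB : {morph D : x y / x - y}.
Hypothesis EB : {morph E : x y / x - y}.
Hypothesis DM : forall x y, D (x * y) = D x * y + x * D y.
Hypothesis EM : forall x y, E (x * y) = E x * y + x * E y.
Hypothesis DEC : forall x, D (E x) = E (D x).

Lemma frac_der_comm x : frac_der D (frac_der E x) = frac_der E (frac_der D x).
Proof.
have [a [b [b0 ->]]] := fracP x.
rewrite !frac_derE // -!tofracXn !frac_derE ?expf_neq0 // expr2 !(DM, EM, DB, EB).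
rewrite !DEC; congr (FracField.tofrac _ / _); ring.
Qed.
End FracDerComm.

Section MpolyFracDer.
Variable k : fieldType.

Definition mfrac_der (i : 'I_3) : {fraction {mpoly k[3]}} -> _ := frac_der (mderiv i).

Fact mfrac_derD i : {morph mfrac_der i : x y / x + y}.
Proof. by apply: frac_derD; [exact: mderivD|exact: mderivM]. Qed.

Fact mfrac_derM i x y : mfrac_der i (x * y) = mfrac_der i x * y + x * mfrac_der i y.
Proof. by apply: frac_derM; exact: mderivM. Qed.

Fact mfrac_der_comm i j x :
  mfrac_der i (mfrac_der j x) = mfrac_der j (mfrac_der i x).
Proof.
by apply: frac_der_comm; [exact: mderivB|exact: mderivB|exact: mderivM
  |exact: mderivM|exact: mderiv_comm].
Qed.

HB.instance Definition _ := Field_isDifferential.Build {fraction {mpoly k[3]}}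
  mfrac_derD mfrac_derM mfrac_der_comm.
End MpolyFracDer.

Definition ratfun (k : fieldType) : diffFieldType := {fraction {mpoly k[3]}}.

Definition of_poly (k : fieldType) (p : {mpoly k[3]}) : ratfun k :=
  @FracField.tofrac {mpoly k[3]} p.

Definition of_cst (k : fieldType) (c : k) : ratfun k := of_poly c%:MP.

Record diffExt (K : diffFieldType) := DiffExt {
  ext_field :> diffFieldType;
  emb : {rmorphism K -> ext_field};
  emb_der : forall i x, der i (emb x) = emb (der i x)
}.

Definition constants (L : diffFieldType) : set L := [set x | forall i, der i x = 0].

Section Forms.
Variable L : diffFieldType.

(* A 1-form is its row of coordinates in dx, dy, dz; a 2-form is its row of
   coordinates in dy/\dz, dz/\dx, dx/\dy; a 3-form is its coefficient of
   dx/\dy/\dz.  Index addition in 'I_3 is modulo 3, so (i, i + 1, i + 2) is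
   always a cyclic permutation of (x, y, z). *)
Definition form1 := 'rV[L]_3.
Definition form2 := 'rV[L]_3.
Definition form3 : Type := L.

Definition mk_form2 (P Q R : L) : form2 := \row_i [:: P; Q; R]`_i.

Definition wedge11 (a b : form1) : form2 :=
  \row_i (a 0 (i + 1) * b 0 (i + 2) - a 0 (i + 2) * b 0 (i + 1)).
Definition wedge12 (a : form1) (w : form2) : form3 := \sum_i a 0 i * w 0 i.

Definition d0 (f : L) : form1 := \row_i der i f.
Definition d1 (a : form1) : form2 :=
  \row_i (der (i + 1) (a 0 (i + 2)) - der (i + 2) (a 0 (i + 1))).
Definition d2 (w : form2) : form3 := \sum_i der i (w 0 i).

Definition dlog (f : L) : form1 := f^-1 *: d0 f.
End Forms.

Definition lift1 (K : diffFieldType) (L : diffExt K) (a : form1 K) : form1 L :=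
  map_mx (@emb K L) a.
Definition lift2 (K : diffFieldType) (L : diffExt K) (w : form2 K) : form2 L :=
  map_mx (@emb K L) w.

Section Liouvillian.
Variable L : diffFieldType.

Definition subfield (S : set L) : Prop :=
  [/\ S 1, forall x y, S x -> S y -> S (x - y) &
      forall x y, S x -> S y -> S (x / y)].

Definition diff_subfield (S : set L) : Prop :=
  subfield S /\ forall i x, S x -> S (der i x).

Definition adjoin (S : set L) (t : L) : set L := smallest subfield (S `|` [set t]).

Definition form1_over (S : set L) (a : form1 L) : Prop := forall i, S (a 0 i).

Definition exponential_step (S T : set L) : Prop :=
  exists (t : L) (a : form1 L),
    [/\ T = adjoin S t, t != 0, form1_over S a & d0 t = t *: a].

Definition primitive_step (S T : set L) : Prop :=
  exists (t : L) (a : form1 L),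
    [/\ T = adjoin S t, form1_over S a & d0 t = a].

Definition finite_step (S T : set L) : Prop :=
  S `<=` T /\
  exists n (b : 'I_n -> L), (forall j, T (b j)) /\
    forall x, T x -> exists c : 'I_n -> L,
      (forall j, S (c j)) /\ x = \sum_j c j * b j.

Definition liouvillian_step (S T : set L) : Prop :=
  [\/ exponential_step S T, primitive_step S T | finite_step S T].
End Liouvillian.

Definition liouvillian (K : diffFieldType) (L : diffExt K) : Prop :=
  @constants L = @emb K L @` @constants K /\
  exists m (F : nat -> set L),
    [/\ F 0 = range (@emb K L), F m = [set: L],
        forall i, (i <= m)%N -> diff_subfield (F i) &
        forall i, (i < m)%N -> liouvillian_step (F i) (F i.+1)].

Definition first_integral (K : diffFieldType) (Omega : form2 K)
    (L : diffExt K) (phi : L) : Prop :=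
  ~ constants phi /\ wedge12 (d0 phi) (lift2 L Omega) = 0.

Definition has_liouvillian_first_integral (K : diffFieldType) (Omega : form2 K) : Prop :=
  exists (L : diffExt K) (phi : L), liouvillian L /\ first_integral Omega phi.

(* An expression exp(g/f) * prod_j f_j^(a_j) denotes an element of a
   differential extension of k(x,y,z): E is a value of exp(g/f) and P j a value
   of f_j^(a_j), each pinned down by its logarithmic differential.  This leaves
   a nonzero constant factor free; over the complex numbers, when the extension
   has no new constants, it is absorbed by adding a constant to g/f. *)
Definition darboux_function (k : fieldType) (L : diffExt (ratfun k)) (m : L) : Prop :=
  exists (f g : {mpoly k[3]}) (n : nat) (fs : 'I_n -> {mpoly k[3]})
         (a : 'I_n -> k) (E : L) (P : 'I_n -> L),
    [/\ f != 0 /\ forall j, fs j != 0,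
        E != 0 /\ dlog E = lift1 L (d0 (of_poly g / of_poly f)),
        forall j, P j != 0 /\
          dlog (P j) = lift1 L (of_cst (a j) *: dlog (of_poly (fs j))) &
        m = E * \prod_j P j].

(* Main.v *)
(* Descent. Along the tower K = K_0 c ... c K_m = L one carries down the
   alternative "(I) or (II) holds with forms over K_i", starting from
   omega = d(phi), alpha = 0 over L.
   - K_{i+1} = K_i(t), t transcendental. With s = t or s = 1/t the derivations
     preserve the ideal (s) of K_i[s], so forms can be reduced modulo s. If the
     closed form alpha (or beta) has a pole at s = 0, its leading coefficient is
     itself an integrable form annihilating Omega, which is case (I).
   - K_{i+1} / K_i finite. The normalized trace commutes with the derivations,
     which settles (II). For (I), write Omega = u ^ v and omega = u + f v with f
     in K_{i+1}; if f is not in K_i, then f solves a Riccati equation along the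
     vector field Omega, and the trace of alpha together with the logarithmic
     derivative of the different of f yields beta, hence (II).

   Conversely a closed form over C(x,y,z) equals
   d(g/f) + sum_j a_j d(f_j)/f_j: integrate in one variable at a time by Hermite
   reduction; closedness forces the residues to be constant. The Darboux
   function m, and in case (I) the integral of omega/m, are then adjoined one at
   a time without new constants. *)

Require Import Defs.
From HB Require Import structures.
From mathcomp Require Import all_boot all_order all_algebra all_field ring.
From mathcomp Require Import boolp classical_sets reals complex mpoly.

Set Implicit Arguments.
Unset Strict Implicit.
Unset Printing Implicit Defensive.

Import GRing.Theory.
Local Open Scope ring_scope.

(** * Differential forms and differential subfields *)

(** Neither alternative descends by itself. Over a finite extension, [omega] has conjugates, and the
    trace of an integrable form need not be integrable; when two conjugates differ, their difference
    measures d Omega instead, which is (II). Conversely, a pole of [beta] turns (II) into (I). Hence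
    the pair is carried down together. A generator of an exponential or primitive step may happen to
    be algebraic; such a step is treated as finite, so that a transcendental step is a rational
    function field with a marked point s = 0. The marked point must be stable under the derivations:
    for an exponential t = 0 is, for a primitive only t = infinity is, whence s = 1/t. In the
    converse direction the obstacle is new constants. Freely adjoining an exponential of a closed
    form c creates one when some n c with n > 0 is a logarithmic differential, and freely adjoining
    a primitive does so when c is exact. These two cases are split off and handled without a free
    generator. *)

Lemma der_is_zmod_morphism (L : diffFieldType) (i : 'I_3) :
  zmod_morphism (@der L i).
Proof. by move=> x y; apply: (addIr (der i y)); rewrite -derD !subrK. Qed.

HB.instance Definition _ (L : diffFieldType) (i : 'I_3) :=
  GRing.isZmodMorphism.Build L L (der i) (@der_is_zmod_morphism L i).

Section DerTheory.
Variable L : diffFieldType.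
Implicit Types (x y : L) (i : 'I_3).

Lemma der1 i : der i (1 : L) = 0.
Proof.
have := derM i (1 : L) 1; rewrite !mulr1 mul1r => /eqP.
by rewrite -subr_eq0 opprD addNKr oppr_eq0 => /eqP.
Qed.

Lemma derV i x : der i x^-1 = - (der i x / x ^+ 2).
Proof.
have [->|x0] := eqVneq x 0; first by rewrite invr0 raddf0 mul0r oppr0.
have := derM i x x^-1; rewrite divff // der1 => e.
by apply: (mulfI x0); rewrite (canRL (addKr _) (esym e)); field.
Qed.

Lemma der_div i x y : y != 0 ->
  der i (x / y) = (der i x * y - x * der i y) / y ^+ 2.
Proof. by move=> y0; rewrite derM derV; field. Qed.

Lemma derX i x n : der i (x ^+ n.+1) = n.+1%:R * x ^+ n * der i x.
Proof.
elim: n => [|n IH]; first by rewrite expr1 expr0 !mul1r.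
by rewrite exprS derM IH exprS -[in RHS]natr1; ring.
Qed.

Lemma der_nat i n : der i (n%:R : L) = 0.
Proof. by rewrite raddfMn /= der1 mul0rn. Qed.

End DerTheory.

Section FormTheory.
Variable L : diffFieldType.
Implicit Types (f g : L) (a b : form1 L) (w : form2 L).

Lemma big_ord3 (h : 'I_3 -> L) : \sum_j h j = h 0 + h 1 + h 2%:R.
Proof.
rewrite !big_ord_recl big_ord0 addr0 addrA.
have -> : lift ord0 ord0 = 1 :> 'I_3 by apply/val_inj.
by have -> : lift ord0 (lift ord0 ord0) = 2%:R :> 'I_3 by apply/val_inj.
Qed.

Lemma sum_cycle (h : 'I_3 -> L) i : \sum_j h j = h i + h (i + 1) + h (i + 2).
Proof. by rewrite (reindex_inj (addrI i)) big_ord3 addr0. Qed.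

Lemma ord3_addE (i : 'I_3) :
  (((i + 1 + 1 = i + 2)%R * (i + 1 + 2 = i)%R) * ((i + 2 + 1 = i)%R * (i + 2 + 2 = i + 1)%R))%type.
Proof. by case: i => [[|[|[|m]]] mlt] //; do !split; apply/val_inj. Qed.

Lemma ord3_cycle (P : 'I_3 -> Prop) i : P i -> P (i + 1) -> P (i + 2) -> forall j, P j.
Proof.
move=> P0 P1 P2 j; rewrite -(subrK i j) [_ + i]addrC; case: (j - i) => [[|[|[|m]]] mlt] //.
- by rewrite (_ : Ordinal mlt = 0) ?addr0 //; apply/val_inj.
- by rewrite (_ : Ordinal mlt = 1) //; apply/val_inj.
by rewrite (_ : Ordinal mlt = 2) //; apply/val_inj.
Qed.

Lemma d1D a b : d1 (a + b) = d1 a + d1 b.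
Proof. by apply/rowP=> i; rewrite !mxE !raddfD /=; ring. Qed.

Lemma d1Z f a : d1 (f *: a) = wedge11 (d0 f) a + f *: d1 a.
Proof. by apply/rowP=> i; rewrite !mxE !derM; ring. Qed.

Lemma d1_d0 f : d1 (d0 f) = 0.
Proof. by apply/rowP=> i; rewrite !mxE der_comm subrr. Qed.

Lemma wedge11_self a : wedge11 a a = 0.
Proof. by apply/rowP=> i; rewrite !mxE mulrC subrr. Qed.

Lemma wedge11Dl a b c : wedge11 (a + b) c = wedge11 a c + wedge11 b c.
Proof. by apply/rowP=> i; rewrite !mxE; ring. Qed.

Lemma wedge11Zl f a b : wedge11 (f *: a) b = f *: wedge11 a b.
Proof. by apply/rowP=> i; rewrite !mxE; ring. Qed.

Lemma wedge11Zr f a b : wedge11 a (f *: b) = f *: wedge11 a b.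
Proof. by apply/rowP=> i; rewrite !mxE; ring. Qed.

Lemma wedge12Dl a b w : wedge12 (a + b) w = wedge12 a w + wedge12 b w.
Proof. by rewrite /wedge12 -big_split; apply: eq_bigr=> i _; rewrite mxE mulrDl. Qed.

Lemma wedge12Zl f a w : wedge12 (f *: a) w = f * wedge12 a w.
Proof. by rewrite /wedge12 mulr_sumr; apply: eq_bigr=> i _; rewrite mxE mulrA. Qed.

Lemma wedge12Zr f a w : wedge12 a (f *: w) = f * wedge12 a w.
Proof. by rewrite /wedge12 mulr_sumr; apply: eq_bigr=> i _; rewrite mxE mulrCA. Qed.

Lemma d2Z f w : d2 (f *: w) = wedge12 (d0 f) w + f * d2 w.
Proof.
by rewrite /d2 /wedge12 mulr_sumr -big_split; apply: eq_bigr=> i _; rewrite !mxE derM.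
Qed.

Lemma d1_dlog f : d1 (dlog f) = 0.
Proof.
apply/rowP=> i; have [->|f0] := eqVneq f 0.
  by rewrite !mxE invr0 !mul0r !raddf0 ?subr0 ?addr0.
by rewrite !mxE !derM !derV der_comm; ring.
Qed.

Lemma dlogM f g : f != 0 -> g != 0 -> dlog (f * g) = dlog f + dlog g.
Proof. by move=> f0 g0; apply/rowP=> i; rewrite !mxE derM; field; rewrite f0 g0. Qed.

Lemma dlogV f : dlog f^-1 = - dlog f.
Proof.
have [->|f0] := eqVneq f 0; apply/rowP=> i; rewrite !mxE.
  by rewrite invr0 !raddf0 ?mulr0 ?oppr0.
by rewrite derV invrK; field.
Qed.

Lemma dlog_prod (I : Type) (r : seq I) (F : I -> L) : (forall j, F j != 0) ->
  dlog (\prod_(j <- r) F j) = \sum_(j <- r) dlog (F j).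
Proof.
move=> F0; elim: r => [|j r IH].
  by rewrite !big_nil; apply/rowP=> i; rewrite !mxE der1 mulr0.
by rewrite !big_cons dlogM ?IH //; elim/big_rec: _ => [|k x _ x0]; rewrite ?oner_neq0 ?mulf_neq0.
Qed.

End FormTheory.

Section SubDiffField.
Variables (L : diffFieldType) (S : set L).
Hypothesis dS : diff_subfield S.

(** The closure proof is an argument of the predicate, so that unification can recover it when the
    subring instance is looked up. *)
Definition subpred (_ : diff_subfield S) : {pred L} := fun x => `[< S x >].
Local Notation Sp := (subpred dS).

Fact subpred_closed : divring_closed Sp.
Proof.
have [[S1 SB SD] _] := id dS; split; first exact/asboolP.
  by move=> x y /asboolP Sx /asboolP Sy; apply/asboolP/SB.
by move=> x y /asboolP Sx /asboolP Sy; apply/asboolP/SD.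
Qed.

HB.instance Definition _ := GRing.isDivringClosed.Build L Sp subpred_closed.

Definition subtypeOf : Type := sig (fun x : L => x \in Sp).
HB.instance Definition _ := [isSub of subtypeOf for @sval L (fun x : L => x \in Sp)].
HB.instance Definition _ := [Choice of subtypeOf by <:].
HB.instance Definition _ := [SubChoice_isSubIntegralDomain of subtypeOf by <:].
HB.instance Definition _ := [SubIntegralDomain_isSubField of subtypeOf by <:].

Fact subder_subproof i (x : subtypeOf) : der i (val x) \in Sp.
Proof. have [_ H] := id dS; exact/asboolP/H/asboolP/(valP x). Qed.

Definition subder i (x : subtypeOf) : subtypeOf :=
  exist (fun y : L => y \in Sp) _ (subder_subproof i x).

Fact subderD i : {morph subder i : x y / x + y}.
Proof. by move=> x y; apply: val_inj; rewrite /= raddfD. Qed.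
Fact subderM i x y : subder i (x * y) = subder i x * y + x * subder i y.
Proof. by apply: val_inj; rewrite /= derM. Qed.
Fact subder_comm i j x : subder i (subder j x) = subder j (subder i x).
Proof. by apply: val_inj; rewrite /= der_comm. Qed.

HB.instance Definition _ :=
  Field_isDifferential.Build subtypeOf subderD subderM subder_comm.

(** Polynomials, matrices and traces need a coefficient field that is a type, while the fields of a
    tower are subsets of [L]. This trades a subset for an embedding [e] with that range. *)
Lemma diff_subfieldP : exists (k : diffFieldType) (e : {rmorphism k -> L}),
  (forall i x, der i (e x) = e (der i x)) /\ range e = S.
Proof.
exists subtypeOf, (val : {rmorphism subtypeOf -> L}); split => //.
apply/seteqP; split => [_ [x _ <-]|x Sx]; first exact/asboolP/(valP x).
have Spx : x \in Sp by apply/asboolP.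
by exists (exist (fun y : L => y \in Sp) x Spx).
Qed.

End SubDiffField.

(** * Characteristic zero and simple extensions *)

Definition char0 (L : fieldType) := forall n, n.+1%:R != 0 :> L.

Lemma char0_nat (L : fieldType) n : char0 L -> (0 < n)%N -> n%:R != 0 :> L.
Proof. by case: n. Qed.

Lemma char0_domain (k L : fieldType) (e : {rmorphism k -> L}) : char0 L -> char0 k.
Proof. by move=> ch n; rewrite -(fmorph_eq0 e) rmorph_nat. Qed.

Lemma char0_codomain (k L : fieldType) (e : {rmorphism k -> L}) : char0 k -> char0 L.
Proof. by move=> ch n; rewrite -(rmorph_nat e) fmorph_eq0. Qed.

Lemma size_deriv_char0 (k : fieldType) (p : {poly k}) : char0 k ->
  size p^`() = (size p).-1.
Proof.
move=> ch; have [->|p0] := eqVneq p 0; first by rewrite linear0 size_poly0.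
case E: (size p) => [|[|n]] /=; first by move/eqP: E; rewrite size_poly_eq0 (negPf p0).
  by have /eqP/size_poly1P [c _ ->] := E; rewrite derivC size_poly0.
apply/eqP; rewrite eqn_leq; apply/andP; split.
  by have := lt_size_deriv p0; rewrite E.
rewrite ltnNge; apply/negP => H; have /leq_sizeP/(_ n (leqnn n)) := H.
rewrite coef_deriv => /eqP; rewrite -mulr_natr mulf_eq0 (negPf (ch n)) orbF.
by have := p0; rewrite -lead_coef_eq0 lead_coefE E /= => /negPf ->.
Qed.

Section Leibniz.
Variables (k L : fieldType) (e : {rmorphism k -> L}).
Variables (D : {additive k -> k}) (D' : {additive L -> L}).
Hypothesis DM' : forall x y, D' (x * y) = D' x * y + x * D' y.
Hypothesis De : forall x, D' (e x) = e (D x).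

(** The chain rule with variable coefficients. The maps [D] and [D'] are abstract because they are
    later partial derivations as well as the derivation along [Omega]. *)
Lemma der_horner (p : {poly k}) t : D' (map_poly e p).[t] =
  (map_poly e (map_poly D p)).[t] + (map_poly e p^`()).[t] * D' t.
Proof.
elim/poly_ind: p => [|p c IH].
  by rewrite linear0 !raddf0 !horner0 raddf0 mul0r addr0.
rewrite derivMXaddC.
have H : map_poly D (p * 'X) = map_poly D p * 'X.
  by apply/polyP=> i; rewrite coef_map !coefMX; case: i => [|i]; rewrite ?raddf0 ?coef_map.
rewrite !raddfD /= {}H map_polyC !rmorphM /= !map_polyX !map_polyC /= !hornerE.
rewrite raddfD /= DM' IH De; ring.
Qed.

End Leibniz.

Section Subfields.
Variables (L : diffFieldType) (S : set L).
Hypothesis sS : subfield S.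

Lemma subfield1 : S 1. Proof. by case: sS. Qed.
Lemma subfieldB x y : S x -> S y -> S (x - y). Proof. by case: sS => _ + _; apply. Qed.
Lemma subfield0 : S 0. Proof. by rewrite -(subrr 1); apply: subfieldB; apply: subfield1. Qed.
Lemma subfieldN x : S x -> S (- x).
Proof. by rewrite -sub0r; apply: subfieldB; apply: subfield0. Qed.
Lemma subfieldD x y : S x -> S y -> S (x + y).
Proof. by move=> Sx Sy; rewrite -[y]opprK; apply: subfieldB => //; apply: subfieldN. Qed.
Lemma subfield_div x y : S x -> S y -> S (x / y). Proof. by case: sS => _ _; apply. Qed.
Lemma subfieldV x : S x -> S x^-1.
Proof. by rewrite -div1r; apply: subfield_div; apply: subfield1. Qed.
Lemma subfieldM x y : S x -> S y -> S (x * y).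
Proof. by move=> Sx Sy; rewrite -[y]invrK; apply: subfield_div => //; apply: subfieldV. Qed.
Lemma subfield_sum (I : Type) (r : seq I) (P : pred I) (F : I -> L) :
  (forall i, P i -> S (F i)) -> S (\sum_(i <- r | P i) F i).
Proof. by move=> H; apply: big_ind; [exact: subfield0|exact: subfieldD|]. Qed.
Lemma subfieldX x n : S x -> S (x ^+ n).
Proof.
by move=> Sx; elim: n => [|n IH]; rewrite ?expr0 ?exprS; [exact: subfield1|exact: subfieldM].
Qed.
Lemma subfield_nat n : S n%:R.
Proof.
by elim: n => [|n IH]; rewrite ?mulr0n -?natr1; [exact: subfield0|apply: subfieldD => //; apply: subfield1].
Qed.

End Subfields.

Section Adjoin.
Variables (L : diffFieldType) (S : set L) (t : L).

Lemma adjoin_subfield : subfield (adjoin S t).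
Proof.
split=> [A [[]]//|x y Sx Sy A hA|x y Sx Sy A hA].
  by case: (hA) => -[_ AB _] _; apply: AB; [apply: Sx|apply: Sy].
by case: (hA) => -[_ _ AD] _; apply: AD; [apply: Sx|apply: Sy].
Qed.

Lemma adjoin_gen : adjoin S t t.
Proof. by move=> A [_ h]; apply: h; right. Qed.

Lemma adjoin_base x : S x -> adjoin S t x.
Proof. by move=> Sx A [_ h]; apply: h; left. Qed.

Lemma adjoin_min (A : set L) : subfield A -> (forall x, S x -> A x) -> A t ->
  forall x, adjoin S t x -> A x.
Proof. by move=> sA SA At x H; apply: (H A); split=> // y [/SA//|->]. Qed.

End Adjoin.

Lemma adjoinV (L : diffFieldType) (S : set L) (t : L) : adjoin S t^-1 = adjoin S t.
Proof.
apply/seteqP; split; apply: adjoin_min.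
- exact: adjoin_subfield.
- exact: adjoin_base.
- by apply: (subfieldV (adjoin_subfield _ _)); apply: adjoin_gen.
- exact: adjoin_subfield.
- exact: adjoin_base.
- by rewrite -[X in adjoin _ _ X]invrK; apply: (subfieldV (adjoin_subfield _ _)); apply: adjoin_gen.
Qed.

Section Eval.
Variables (k L : fieldType) (e : {rmorphism k -> L}) (t : L).

Definition ev : {poly k} -> L := horner_eval t \o map_poly e.
HB.instance Definition _ := GRing.RMorphism.on ev.

Lemma evE p : ev p = (map_poly e p).[t]. Proof. by []. Qed.
Lemma evC c : ev c%:P = e c. Proof. by rewrite evE map_polyC hornerC. Qed.
Lemma evX : ev 'X = t. Proof. by rewrite evE map_polyX hornerX. Qed.
Lemma evZ c p : ev (c *: p) = e c * ev p.
Proof. by rewrite -mul_polyC rmorphM /= evC. Qed.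

Definition algebraic := exists2 p : {poly k}, p != 0 & ev p = 0.

Lemma ev_inj : ~ algebraic -> injective ev.
Proof.
move=> na p q epq; apply/eqP; rewrite -subr_eq0; apply/negP => /negP pq0; apply: na.
by exists (p - q) => //; rewrite rmorphB /= epq subrr.
Qed.

Lemma ev_eq0 p : ~ algebraic -> (ev p == 0) = (p == 0).
Proof. by move=> /ev_inj inj; rewrite -(rmorph0 ev) (inj_eq inj). Qed.

(** [p] is an annihilating polynomial of least size. A denominator [b] with nonzero value is prime
    to it: the quotient [r] of [p] by the gcd still kills [t], so minimality makes the gcd constant.
    Bezout then inverts the value of [b], and division by [p] lowers the degree. *)
Lemma algebraic_basis : algebraic -> exists n (p : {poly k}),
  [/\ size p = n.+2, ev p = 0, forall q : {poly k}, (size q <= n.+1)%N -> ev q = 0 -> q = 0 &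
      forall x, (exists a b, ev b != 0 /\ x = ev a / ev b) ->
                exists2 q : {poly k}, (size q <= n.+1)%N & x = ev q].
Proof.
move=> [p0 p00 ep0].
pose P n := `[< exists p : {poly k}, [/\ p != 0, ev p = 0 & size p = n] >].
have exP : exists n, P n by exists (size p0); apply/asboolP; exists p0.
case: (ex_minnP exP) => m /asboolP [p [pn0 ep sp]] mmin.
have small (q : {poly k}) : (size q < m)%N -> ev q = 0 -> q = 0.
  move=> sq eq; apply/eqP; apply/negP => /negP q0.
  have /mmin : P (size q) by apply/asboolP; exists q.
  by rewrite leqNgt sq.
case: m sp mmin small => [|[|n]] sp mmin small.
- by move/eqP: sp; rewrite size_poly_eq0 (negPf pn0).
- have /eqP/size_poly1P [c c0 pc] := sp.
  by move: ep => /eqP; rewrite pc evC fmorph_eq0 (negPf c0).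
exists n, p; split=> // x [a [b [eb0 ->]]].
have [u [v uv]] : exists u v : {poly k}, u * p + v * b %= gcdp p b.
  by have [[u v] /=] := Bezoutp p b; exists u, v.
have gb : gcdp p b %| b by exact: dvdp_gcdr.
have /dvdpP [r pr] : gcdp p b %| p by exact: dvdp_gcdl.
have eg0 : ev (gcdp p b) != 0.
  apply: contraNneq eb0 => eg; have /dvdpP [s ->] := gb.
  by rewrite rmorphM /= eg mulr0.
have er : ev r = 0.
  by move: ep; rewrite pr rmorphM => /eqP; rewrite mulf_eq0 (negPf eg0) orbF => /eqP.
have g0 : gcdp p b != 0 by apply: contraNneq eg0 => ->; rewrite rmorph0.
have r0 : r != 0 by apply: contraNneq pn0; rewrite pr => ->; rewrite mul0r.
have sr : (size p <= size r)%N by rewrite sp; apply: mmin; apply/asboolP; exists r.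
have sg : size (gcdp p b) = 1%N.
  move: sr; rewrite {1}pr size_mul // -subn1 leq_subLR addnC leq_add2r.
  by move=> h; apply/eqP; rewrite eqn_leq h lt0n size_poly_eq0.
have /size_poly1P [c c0 uvc] : size (u * p + v * b) == 1%N by rewrite (eqp_size uv) sg.
have vb : ev v * ev b = e c.
  by rewrite -evC -uvc rmorphD !rmorphM /= ep mulr0 add0r.
exists ((c^-1 *: (a * v)) %% p).
  by rewrite -ltnS -sp ltn_modp.
have -> : ev (c^-1 *: (a * v) %% p) = ev (c^-1 *: (a * v)).
  by rewrite [in RHS](divp_eq (c^-1 *: (a * v)) p) rmorphD rmorphM /= ep mulr0 add0r.
have ec0 : e c != 0 by rewrite fmorph_eq0.
by rewrite evZ rmorphM fmorphV /= -vb; field; rewrite eb0 -(mulIr_eq0 _ (mulIf eb0)) vb ec0.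
Qed.

End Eval.

Lemma ev_comp (k L : fieldType) (e : {rmorphism k -> L}) (t : L) (P c : {poly k}) :
  ev e t (P \Po c) = ev e (ev e t c) P.
Proof.
elim/poly_ind: P => [|P d IH]; first by rewrite comp_poly0 !rmorph0.
by rewrite comp_poly_MXaddC !rmorphD !rmorphM /= IH !evC evX.
Qed.

Section AdjoinEval.
Variables (k L : diffFieldType) (e : {rmorphism k -> L}) (t : L).

Lemma adjoinP x : adjoin (range e) t x <->
  exists a b, ev e t b != 0 /\ x = ev e t a / ev e t b.
Proof.
split; last first.
  have sA := adjoin_subfield (range e) t.
  have H p : adjoin (range e) t (ev e t p).
    elim/poly_ind: p => [|p c IH]; first by rewrite rmorph0; apply: (subfield0 sA).
    rewrite rmorphD rmorphM /= evX evC; apply: (subfieldD sA) => //.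
      by apply: (subfieldM sA) => //; apply: adjoin_gen.
    by apply: adjoin_base; exists c.
  by move=> [a [b [_ ->]]]; apply: (subfield_div sA).
move: x; apply: adjoin_min.
- split.
  + by exists 1, 1; rewrite rmorph1 oner_neq0 divr1.
  + move=> _ _ [a [b [b0 ->]]] [c [d [d0 ->]]].
    by exists (a * d - c * b), (b * d); rewrite rmorphB !rmorphM mulf_neq0 //=; split=> //; field; rewrite b0 d0.
  + move=> _ _ [a [b [b0 ->]]] [c [d [d0 ->]]].
    have [->|c0] := eqVneq (ev e t c) 0.
      by exists 0, 1; rewrite rmorph0 rmorph1 oner_neq0 !mul0r invr0 mulr0.
    by exists (a * d), (b * c); rewrite !rmorphM mulf_neq0 //=; split=> //; field; rewrite b0 c0 d0.
- by move=> _ [c _ <-]; exists c%:P, 1; rewrite rmorph1 evC oner_neq0 divr1.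
- by exists 'X, 1; rewrite rmorph1 evX oner_neq0 divr1.
Qed.

Lemma adjoin_reduced_fraction x : adjoin (range e) t x -> exists a b : {poly k},
  [/\ coprimep b a, b \is monic, ev e t b != 0 & x = ev e t a / ev e t b].
Proof.
move=> /adjoinP [a [b [b0 xE]]].
have bN0 : b != 0 by apply: contraNneq b0 => ->; rewrite rmorph0.
have gN0 : gcdp a b != 0 by rewrite gcdp_eq0 (negPf bN0) andbF.
have cop : coprimep (a %/ gcdp a b) (b %/ gcdp a b).
  by apply: coprimep_div_gcd; rewrite bN0 orbT.
have /dvdpP [a1 aE] := dvdp_gcdl a b; have /dvdpP [b1 bE] := dvdp_gcdr a b.
move: gN0 aE bE cop; move: (gcdp a b) => g gN0 aE bE.
rewrite {1}aE {1}bE !mulpK // => cop.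
have b1N0 : b1 != 0 by apply: contraNneq bN0; rewrite bE => ->; rewrite mul0r.
have lc0 : (lead_coef b1)^-1 != 0 by rewrite invr_eq0 lead_coef_eq0.
move: b0 xE; rewrite aE bE !rmorphM /= mulf_eq0 negb_or => /andP [b1E0 gE0] xE.
exists ((lead_coef b1)^-1 *: a1), ((lead_coef b1)^-1 *: b1); split.
- by rewrite coprimepZl // coprimepZr // coprimep_sym.
- by apply/monicP; rewrite lead_coefZ mulVf // -invr_eq0.
- by rewrite evZ mulf_neq0 // fmorph_eq0.
- by rewrite xE !evZ; field; apply/and3P; rewrite fmorph_eq0 lead_coef_eq0.
Qed.

Hypothesis he : forall i x, der i (e x) = e (der i x).

Lemma der_ev i p : der i (ev e t p) =
  ev e t (map_poly (der i) p) + ev e t p^`() * der i t.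
Proof. by rewrite !evE; exact: (@der_horner _ _ e (der i) (der i) (derM i) (he i)). Qed.

Lemma adjoin_diff : (forall i, adjoin (range e) t (der i t)) ->
  diff_subfield (adjoin (range e) t).
Proof.
move=> ht; have sA := adjoin_subfield (range e) t; split=> // i x.
have evA p : adjoin (range e) t (ev e t p).
  by apply/adjoinP; exists p, 1; rewrite rmorph1 oner_neq0 divr1.
have dA p : adjoin (range e) t (der i (ev e t p)).
  by rewrite der_ev; apply: (subfieldD sA) => //; apply: (subfieldM sA).
move=> /adjoinP [a [b [b0 ->]]]; rewrite der_div //.
by apply: (subfield_div sA); [apply: (subfieldB sA)|apply: (subfieldX sA)] => //; apply: (subfieldM sA).
Qed.

(** Differentiating p(t) = 0 for the minimal polynomial p expresses the derivative of t through
    p'(t), which is nonzero: in characteristic zero p' is a nonzero polynomial of smaller size. *)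
Lemma algebraic_diff : char0 L -> algebraic e t -> diff_subfield (adjoin (range e) t).
Proof.
move=> ch /algebraic_basis [n [p [sp ep pmin _]]]; apply: adjoin_diff => i.
have dp0 : ev e t p^`() != 0.
  apply/negP => /eqP /pmin; have chk := char0_domain e ch.
  rewrite size_deriv_char0 // sp /= leqnn => /(_ isT) /eqP.
  by rewrite -size_poly_eq0 size_deriv_char0 // sp.
have := der_ev i p; rewrite ep raddf0 => /esym/eqP; rewrite addrC addr_eq0 => /eqP h.
apply/adjoinP; exists (- map_poly (der i) p), p^`(); split=> //.
by rewrite rmorphN /= -h mulrAC divff // mul1r.
Qed.

End AdjoinEval.

(** * Traces of finite differential extensions *)

Section FiniteBasis.
Variables (k L : fieldType) (e : {rmorphism k -> L}) (T : set L).

Definition spans n (b : 'I_n -> L) := (forall j, T (b j)) /\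
  forall x, T x -> exists c : 'I_n -> k, x = \sum_j e (c j) * b j.

Definition independent n (b : 'I_n -> L) :=
  forall c : 'I_n -> k, \sum_j e (c j) * b j = 0 -> forall j, c j = 0.

(** A spanning family of least length is independent, since a nontrivial relation would eliminate
    one member. *)
Lemma spans_basis n (b : 'I_n -> L) : spans b ->
  exists m (b' : 'I_m -> L), spans b' /\ independent b'.
Proof.
move=> sb; pose P m := `[< exists b' : 'I_m -> L, spans b' >].
have exP : exists m, P m by exists n; apply/asboolP; exists b.
case: (ex_minnP exP) => m /asboolP [b' sb'] mmin; exists m, b'; split=> // c c0 l.
apply/eqP; apply/negP => /negP cl0; case: m b' sb' mmin c c0 l cl0 => [|m] b' [Tb' sb'] mmin c c0 l cl0.
  by case: l {cl0}.
have : P m; last by move=> /mmin; rewrite ltnn.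
apply/asboolP; exists (fun j => b' (lift l j)); split=> // x /sb' [d ->].
exists (fun j => d (lift l j) - d l / c l * c (lift l j)).
have ecl0 : e (c l) != 0 by rewrite fmorph_eq0.
rewrite (bigD1_ord l) //=; move: c0; rewrite (bigD1_ord l) //= => /eqP.
rewrite addr_eq0 => /eqP bl.
have -> : b' l = - (e (c l))^-1 * \sum_(i < m) e (c (lift l i)) * b' (lift l i).
  by rewrite mulNr -mulrN -bl mulrA mulVf // mul1r.
rewrite mulrA mulr_sumr -big_split /=; apply: eq_bigr => i _.
by rewrite rmorphB !rmorphM fmorphV /=; ring.
Qed.

End FiniteBasis.

Section Trace.
Variables (k L : diffFieldType) (e : {rmorphism k -> L}) (T : set L).
Hypothesis he : forall i x, der i (e x) = e (der i x).
Hypothesis dT : diff_subfield T.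
Hypothesis eT : forall c, T (e c).
Hypothesis ch : char0 L.
Variables (n : nat) (b : 'I_n -> L).
Hypotheses (sb : spans e T b) (ib : independent e b).

Lemma basis_gt0 : (0 < n)%N.
Proof.
case: n b sb => // b' [_ /(_ 1)]; case=> [|c]; first by case: dT => -[].
by rewrite big_ord0 => /eqP; rewrite oner_eq0.
Qed.

(* [tau x] is [1/n] times the trace of multiplication by [x], and the polynomial
   in the last clause is the characteristic polynomial of that multiplication. *)
Lemma normalized_trace : exists tau : L -> k,
  [/\ forall x y, T x -> T y -> tau (x + y) = tau x + tau y,
      forall c x, T x -> tau (e c * x) = c * tau x,
      forall c, tau (e c) = c,
      forall i x, T x -> tau (der i x) = der i (tau x) &
      forall x, T x -> exists p : {poly k},
        [/\ p \is monic, size p = n.+1, p`_n.-1 = - n%:R * tau x & ev e x p = 0]].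
Proof.
have [sT dT'] := dT; have [Tb sb'] := sb; have n0 := basis_gt0.
pose br : 'rV[L]_n := \row_j b j.
have inj (A B : 'M[k]_n) : br *m map_mx e A = br *m map_mx e B -> A = B.
  move=> AB; apply/matrixP=> i j; apply/eqP; rewrite -subr_eq0; apply/eqP.
  apply: (ib (c := fun i => A i j - B i j)).
  move/rowP: AB => /(_ j); rewrite !mxE => /eqP; rewrite -subr_eq0 -sumrB => /eqP h.
  by apply: etrans h; apply: eq_bigr => l _; rewrite !mxE rmorphB /=; ring.
have coord (F : 'I_n -> L) : (forall j, T (F j)) ->
    exists A : 'M[k]_n, \row_j F j = br *m map_mx e A.
  move=> TF; have [c hc] := choice (fun j => sb' _ (TF j)).
  exists (\matrix_(i, j) c j i); apply/rowP=> j; rewrite !mxE (hc j).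
  by apply: eq_bigr => l _; rewrite !mxE mulrC.
have exM x : exists A : 'M[k]_n, T x -> x *: br = br *m map_mx e A.
  have [Tx|nTx] := pselect (T x); last by exists 0.
  have [A hA] := coord (fun j => x * b j) (fun j => subfieldM sT Tx (Tb j)).
  by exists A => _; rewrite -hA; apply/rowP => j; rewrite !mxE.
have [M hM] := choice exM.
have MD x y : T x -> T y -> M (x + y) = M x + M y.
  move=> Tx Ty; apply: inj; rewrite -hM; last exact: subfieldD.
  by rewrite scalerDl map_mxD mulmxDr -!hM.
have MZ c x : T x -> M (e c * x) = c *: M x.
  move=> Tx; apply: inj; rewrite -hM; last exact: subfieldM.
  by rewrite map_mxZ -scalemxAr -hM // scalerA.
have MC c : M (e c) = c%:M.
  by apply: inj; rewrite -hM // map_scalar_mx mul_mx_scalar.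
(* With [N] the matrix of the derivation on the basis, differentiating x b = b M(x) shows that M(der
   x) is the entrywise derivative of M(x) plus a commutator with [N], which has trace zero. *)
have trd x i : T x -> \tr (M (der i x)) = der i (\tr (M x)).
  move=> Tx; have [N hN] := coord (fun j => der i (b j)) (fun j => dT' i _ (Tb j)).
  have -> : M (der i x) = map_mx (der i) (M x) + (N *m M x - M x *m N).
    apply: inj; rewrite -hM; last exact: dT'.
    rewrite map_mxD map_mxB !map_mxM mulmxDr mulmxBr !mulmxA -hM // -hN.
    rewrite -scalemxAl -hN.
    apply/rowP=> j; have /rowP /(_ j) := hM x Tx; rewrite !mxE => /(congr1 (der i)).
    rewrite derM raddf_sum /= => /(canRL (addrK _)) ->; rewrite addrA.
    congr (_ - _); rewrite -big_split /=; apply: eq_bigr => l _.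
    by rewrite !mxE derM he addrC.
  rewrite mxtraceD raddfB /= (mxtrace_mulC N) subrr addr0.
  by rewrite /mxtrace raddf_sum; apply: eq_bigr => j _; rewrite mxE.
have nz : n%:R != 0 :> k by apply: char0_nat n0; apply: char0_domain ch.
exists (fun x => \tr (M x) / n%:R); split.
- by move=> x y Tx Ty; rewrite MD // mxtraceD mulrDl.
- by move=> c x Tx; rewrite MZ // mxtraceZ mulrA.
- by move=> c; rewrite MC mxtrace_scalar -[c *+ n]mulr_natr mulfK.
- by move=> i x Tx; rewrite trd // der_div // der_nat; field.
move=> x Tx; exists (char_poly (M x)); split.
- exact: char_poly_monic.
- by rewrite size_char_poly.
- by rewrite char_poly_trace //; field.
(* The row of basis vectors is a left eigenvector of M(x) with eigenvalue x. *)
apply/eqP; rewrite evE map_char_poly -/(root _ _) -eigenvalue_root_char.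
apply/eigenvalueP; exists br; first by rewrite -hM.
apply/eqP => br0; have := ib (c := fun _ => 1).
have -> : \sum_j e 1 * b j = 0.
  by apply: big1 => j _; have /rowP /(_ j) := br0; rewrite !mxE => ->; rewrite mulr0.
by move=> /(_ erefl (Ordinal n0)) /eqP; rewrite oner_eq0.
Qed.

End Trace.

(** * Transcendental steps *)

Definition caseI (K : diffFieldType) (Omega : form2 K) :=
  exists omega alpha : form1 K, [/\ omega != 0, wedge12 omega Omega = 0,
    wedge11 alpha omega = d1 omega & d1 alpha = 0].

Definition caseII (K : diffFieldType) (Omega : form2 K) :=
  exists beta : form1 K, d2 Omega = wedge12 beta Omega /\ d1 beta = 0.

Definition caseI_over (L : diffFieldType) (S : set L) (Omega : form2 L) :=
  exists omega alpha : form1 L, [/\ form1_over S omega /\ form1_over S alpha,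
    omega != 0, wedge12 omega Omega = 0,
    wedge11 alpha omega = d1 omega & d1 alpha = 0].

Definition caseII_over (L : diffFieldType) (S : set L) (Omega : form2 L) :=
  exists beta : form1 L, [/\ form1_over S beta, d2 Omega = wedge12 beta Omega & d1 beta = 0].

Section FormEmbedding.
Variables (k L : diffFieldType) (e : {rmorphism k -> L}).
Hypothesis he : forall i x, der i (e x) = e (der i x).
Implicit Types (a b : form1 k) (w : form2 k) (f : k).

Lemma map_d0 f : d0 (e f) = map_mx e (d0 f).
Proof. by apply/rowP=> i; rewrite !mxE he. Qed.
Lemma map_d1 a : d1 (map_mx e a) = map_mx e (d1 a).
Proof. by apply/rowP=> i; rewrite !mxE !he rmorphB. Qed.
Lemma map_d2 w : d2 (map_mx e w) = e (d2 w).
Proof. by rewrite /d2 rmorph_sum; apply: eq_bigr => i _; rewrite mxE he. Qed.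
Lemma map_wedge11 a b : wedge11 (map_mx e a) (map_mx e b) = map_mx e (wedge11 a b).
Proof. by apply/rowP=> i; rewrite !mxE rmorphB !rmorphM. Qed.
Lemma map_wedge12 a w : wedge12 (map_mx e a) (map_mx e w) = e (wedge12 a w).
Proof. by rewrite /wedge12 rmorph_sum; apply: eq_bigr => i _; rewrite !mxE rmorphM. Qed.
Lemma map_dlog f : dlog (e f) = map_mx e (dlog f).
Proof. by rewrite /dlog map_d0 map_mxZ fmorphV. Qed.

Lemma map_row_inj n : injective (@map_mx _ _ e 1 n).
Proof. by move=> a b /rowP ab; apply/rowP=> i; have := ab i; rewrite !mxE => /fmorph_inj. Qed.

Lemma form1_overP (a : form1 L) : form1_over (range e) a <-> exists a0, a = map_mx e a0.
Proof.
split=> [H|[a0 ->] i]; last by rewrite mxE; exists (a0 0 i).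
have [c hc] := choice (fun i => let: ex_intro2 x _ h := H i in ex_intro (fun x => e x = a 0 i) x h).
by exists (\row_i c i); apply/rowP=> i; rewrite !mxE hc.
Qed.

Lemma caseI_map w : caseI_over (range e) (map_mx e w) <-> caseI w.
Proof.
split=> [[o [a [[/form1_overP [o0 ->] /form1_overP [a0 ->]]]]]|[o [a [oN0 ow ao ca]]]].
  rewrite map_wedge12 map_wedge11 !map_d1 => oN0 /eqP; rewrite fmorph_eq0 => /eqP ow.
  move=> /map_row_inj ao; rewrite -(map_mx0 e) => /map_row_inj ca.
  by exists o0, a0; split=> //; apply: contraNneq oN0 => ->; rewrite map_mx0.
exists (map_mx e o), (map_mx e a).
rewrite map_wedge12 map_wedge11 !map_d1 ow ao ca rmorph0 map_mx0; split=> //.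
  by split; apply/form1_overP; [exists o|exists a].
by rewrite -(map_mx0 e) (inj_eq (@map_row_inj _)).
Qed.

Lemma caseII_map w : caseII_over (range e) (map_mx e w) <-> caseII w.
Proof.
split=> [[b [/form1_overP [b0 ->]]]|[b [db cb]]].
  rewrite map_d2 map_wedge12 map_d1 => /fmorph_inj db.
  by rewrite -(map_mx0 e) => /map_row_inj cb; exists b0.
exists (map_mx e b); rewrite map_d2 map_wedge12 map_d1 db cb map_mx0; split=> //.
by apply/form1_overP; exists b.
Qed.

End FormEmbedding.

Lemma parallel_wedge12 (K : diffFieldType) (a w : form1 K) (Om : form2 K) :
  wedge11 a w = 0 -> w != 0 -> wedge12 w Om = 0 -> wedge12 a Om = 0.
Proof.
move=> /rowP aw w0 wO.
have [i wi] : exists i, w 0 i != 0.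
  apply/existsP; rewrite -negb_forall; apply: contraNN w0 => /forallP h.
  by apply/eqP/rowP=> i; rewrite mxE; apply/eqP.
suff H j : a 0 j * w 0 i = a 0 i * w 0 j.
  apply: (mulIf wi); rewrite mul0r /wedge12 mulr_suml.
  rewrite (eq_bigr (fun j => a 0 i * (w 0 j * Om 0 j))) -?mulr_sumr.
    by rewrite -/(wedge12 w Om) wO mulr0.
  by move=> j _; rewrite mulrAC H mulrA.
have E l : a 0 (l + 1) * w 0 (l + 2) = a 0 (l + 2) * w 0 (l + 1).
  by apply/eqP; rewrite -subr_eq0; have := aw l; rewrite !mxE => ->.
apply: (ord3_cycle (P := fun j => a 0 j * w 0 i = a 0 i * w 0 j) (i := i)) => //.
  by have := E (i + 2); rewrite !ord3_addE => ->.
by have := E (i + 1); rewrite !ord3_addE => ->.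
Qed.

(* [Pder i] is the derivation of k[s] induced by the [i]-th derivation; it
   preserves the ideal (s), so that evaluation at 0 commutes with it. *)
Section TranscendentalStep.
Variables (k L : diffFieldType) (e : {rmorphism k -> L}).
Hypothesis he : forall i x, der i (e x) = e (der i x).
Variables (s : L) (eta : 'I_3 -> {poly k}).
Hypothesis ns : ~ algebraic e s.
Hypothesis ds : forall i, der i s = s * ev e s (eta i).
Local Notation "p %:E" := (ev e s p) (at level 2, format "p %:E").
Local Notation T := (adjoin (range e) s).

Let Pder i p : {poly k} := map_poly (der i) p + p^`() * 'X * eta i.

Let derE i p : der i p%:E = (Pder i p)%:E.
Proof. by rewrite der_ev // ds !rmorphD !rmorphM /= evX mulrA. Qed.

Let Pder0 i p : (Pder i p).[0] = der i p.[0].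
Proof. by rewrite /Pder hornerD !hornerM hornerX mulr0 mul0r addr0 !horner_coef0 coef_map. Qed.

Let ev0 p q : p%:E = q%:E -> p.[0] = q.[0].
Proof. by move/(ev_inj ns) ->. Qed.

Let s0 : s != 0.
Proof. by rewrite -[s](evX e) ev_eq0 // polyX_eq0. Qed.

Let TE p : T p%:E.
Proof. by apply/adjoinP; exists p, 1; rewrite rmorph1 oner_neq0 divr1. Qed.

Let dT : diff_subfield T.
Proof. by apply: adjoin_diff => // i; rewrite ds -[X in X * _](evX e) -rmorphM; apply: TE. Qed.

(** A form with coefficients in k[s] is kept as a family of polynomials: [evf] reads it over [L],
    [red] reduces it at s = 0. Exterior differentiation commutes with both, which is how identities
    over [L] reach [k]. *)
Let evf (w : 'I_3 -> {poly k}) : form1 L := \row_i (w i)%:E.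
Let red (w : 'I_3 -> {poly k}) : form1 k := \row_i (w i).[0].

Let red_d1 w i : (Pder (i + 1) (w (i + 2)) - Pder (i + 2) (w (i + 1))).[0] = d1 (red w) 0 i.
Proof. by rewrite !mxE hornerD hornerN !Pder0. Qed.

Let evf_d1 w i : (Pder (i + 1) (w (i + 2)) - Pder (i + 2) (w (i + 1)))%:E = d1 (evf w) 0 i.
Proof. by rewrite !mxE rmorphB /= -!derE. Qed.

Let clear_denoms (w : form1 L) : form1_over T w ->
  exists b w', b != 0 /\ b%:E *: w = evf w'.
Proof.
move=> Tw.
have [a ha] := choice (fun i => (adjoinP e s (w 0 i)).1 (Tw i)).
have [b hb] := choice ha.
exists (\prod_i b i), (fun i => a i * \prod_(j | j != i) b j); split.
  apply/prodf_neq0 => i _; apply/eqP => bi.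
  by case: (hb i); rewrite bi rmorph0 eqxx.
apply/rowP=> i; rewrite !mxE; have [bi0 ->] := hb i.
by rewrite (bigD1 i) //= !rmorphM /=; field.
Qed.

Let factorX (p : {poly k}) : p.[0] = 0 -> exists q, p = q * 'X.
Proof.
by move/eqP => /factor_theorem [q ->]; exists q; rewrite polyC0 subr0.
Qed.

Let redP w : red w = 0 -> exists q : 'I_3 -> {poly k}, forall j, w j = q j * 'X.
Proof.
move=> /rowP r0; have h j : (w j).[0] = 0 by have := r0 j; rewrite !mxE.
by have [q hq] := choice (fun j => factorX (h j)); exists q.
Qed.

(** Once denominators are cleared, s is divided out as long as the reduction vanishes; this stops
    because the size of a fixed nonzero coefficient drops each time. *)
Let normalize1 (w : form1 L) : form1_over T w -> w != 0 ->
  exists g w', [/\ T g, g != 0, g *: w = evf w' & red w' != 0].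
Proof.
move=> Tw wN0; have [b [w' [b0 bw]]] := clear_denoms Tw.
have [i wi] : exists i, w 0 i != 0.
  apply/existsP; rewrite -negb_forall; apply: contraNN wN0 => /forallP h.
  by apply/eqP/rowP=> i; rewrite mxE; apply/eqP.
have : exists g w', [/\ T g, g != 0 & g *: w = evf w'].
  by exists b%:E, w'; rewrite ev_eq0.
move=> [g [{bw}w' [Tg g0 bw]]] {b b0}.
have [n hn] := ubnP (size (w' i)); elim: n => // n IH in g w' Tg g0 bw hn *.
have [r0|rN] := eqVneq (red w') 0; last by exists g, w'.
have [q hq] := redP r0.
have wiE : (w' i)%:E = g * w 0 i by move/rowP: bw => /(_ i); rewrite !mxE.
have q0 : q i != 0.
  apply/eqP => q0; move: wiE; rewrite hq q0 mul0r rmorph0 => /esym/eqP.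
  by rewrite mulf_eq0 (negPf g0) (negPf wi).
apply: (IH (g / s) q).
- by apply: (subfield_div dT.1) => //; apply: adjoin_gen.
- by rewrite mulf_neq0 ?invr_eq0.
- apply/rowP=> j; move/rowP: bw => /(_ j); rewrite !mxE hq rmorphM /= evX mulrAC => ->.
  by field.
- by move: hn; rewrite hq size_mulX // ltnS.
Qed.

(** Here [M] is the order of the pole at s = 0, and a form without pole is left as it is. Minimality
    of [M] makes the leading coefficient nonzero as soon as M > 0. *)
Let normalize2 (w : form1 L) : form1_over T w -> exists M b w',
  [/\ b.[0] != 0, (s ^+ M * b%:E) *: w = evf w' & M = 0 \/ red w' != 0].
Proof.
move=> Tw; pose P M := `[< exists b w', b.[0] != 0 /\ (s ^+ M * b%:E) *: w = evf w' >].
have exP : exists M, P M.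
  have [b [w' [b0 bw]]] := clear_denoms Tw.
  have [m [q q0 bq]] := multiplicity_XsubC b 0.
  exists m; apply/asboolP; exists q, w'; split; first by move: q0; rewrite b0.
  by rewrite -bw bq polyC0 subr0 rmorphM rmorphXn /= evX mulrC.
case: (ex_minnP exP) => M /asboolP [b [w' [b0 bw]]] mmin; exists M, b, w'; split=> //.
have [r0|rN] := eqVneq (red w') 0; [left|by right].
case: M bw mmin => // M bw mmin; have [q hq] := redP r0.
have /mmin : P M; last by rewrite ltnn.
apply/asboolP; exists b, q; split=> //; apply/rowP=> j; apply: (mulfI s0).
move/rowP: bw => /(_ j); rewrite !mxE hq rmorphM /= evX exprS !mulrA => ->.
by rewrite mulrC.
Qed.

(* Either [a] has no pole at s = 0 and its value there is closed, or its leading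
   coefficient [red a'] satisfies the equations of case (I). *)
Let closed_normal (a : form1 L) : form1_over T a -> d1 a = 0 ->
  exists c a', [/\ c%:E *: a = evf a', c != 0 &
   (c.[0] != 0 /\ d1 (c.[0]^-1 *: red a') = 0) \/
   [/\ c.[0] = 0, red a' != 0 &
     exists g, d1 g = 0 /\ wedge11 g (red a') = d1 (red a')]].
Proof.
move=> Ta ca; have [M [b [a' [b0 ba M0]]]] := normalize2 Ta.
have bN0 : b != 0 by apply: contraNneq b0 => ->; rewrite horner0.
have bE0 : b%:E != 0 by rewrite ev_eq0.
exists ('X^M * b), a'; rewrite rmorphM rmorphXn /= evX ba mulf_neq0 ?expf_neq0 ?polyX_eq0 //.
(* [evf eta] is dlog s, hence closed, and so is its reduction. *)
have ceta : d1 (red eta) = 0.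
  have : d1 (dlog s) = 0 by apply: d1_dlog.
  have -> : dlog s = evf eta by apply/rowP=> i; rewrite !mxE ds mulKf.
  move=> /rowP h; apply/rowP=> i; rewrite -red_d1 mxE; set r := (_ - _).
  have /ev0 -> : r%:E = 0%:E by rewrite /r evf_d1 h mxE rmorph0.
  exact: horner0.
(* Differentiating a' = s^M b a with a closed gives b da' = (M b eta + db) /\ a'; this is its value
   at s = 0. *)
have key : b.[0] *: d1 (red a') =
    wedge11 ((M%:R * b.[0]) *: red eta + d0 b.[0]) (red a').
  have : b%:E *: d1 (evf a') = wedge11 ((M%:R * b%:E) *: evf eta + d0 b%:E) (evf a').
    rewrite -ba d1Z ca scaler0 addr0 wedge11Zr -!wedge11Zl; congr (wedge11 _ a).
    apply/rowP=> i; rewrite !mxE derM; case: (M) => [|m].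
      by rewrite !expr0 der1; ring.
    by rewrite derX ds exprS; ring.
  move=> /rowP h; apply/rowP=> i.
  have := h i; rewrite mxE -evf_d1 -rmorphM.
  set r := (_ * _); have -> : (wedge11 ((M%:R * b%:E) *: evf eta + d0 b%:E) (evf a')) 0 i =
     ((M%:R * b * eta (i + 1) + Pder (i + 1) b) * a' (i + 2) -
      (M%:R * b * eta (i + 2) + Pder (i + 2) b) * a' (i + 1))%:E.
    by rewrite !mxE !derE rmorphB !(rmorphM, rmorphD) /= rmorph_nat.
  move/ev0; rewrite /r hornerM red_d1 => H; rewrite [LHS]mxE H.
  have E j : (M%:R * b * eta j + Pder j b).[0] = M%:R * b.[0] * (eta j).[0] + der j b.[0].
    by rewrite hornerD Pder0 !hornerM -polyC_natr hornerC.
  by rewrite hornerD hornerN !hornerM !E !mxE.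
split=> //.
case: M M0 ba key => [|M] M0 ba key; [left|right].
  rewrite expr0 mul1r; split=> //.
  have dk : d1 (red a') = b.[0]^-1 *: (b.[0] *: d1 (red a')).
    by rewrite scalerA mulVf // scale1r.
  by rewrite d1Z dk key; apply/rowP=> i; rewrite !mxE !derV; field.
rewrite hornerM hornerXn expr0n mul0r; split=> //; first by case: M0.
(* The leading coefficient behaves like s^(M+1) b times a closed form, so its multiplier is the
   reduction of dlog (s^(M+1) b). *)
exists (M.+1%:R *: red eta + dlog b.[0]); split.
  rewrite d1D d1_dlog d1Z ceta scaler0 !addr0.
  by apply/rowP=> i; rewrite !mxE !der_nat; ring.
apply: (scalerI b0); rewrite key -wedge11Zl; congr (wedge11 _ _).
by apply/rowP=> i; rewrite !mxE; field.
Qed.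

Variable Omega : form2 k.
Local Notation OmL := (map_mx e Omega).

Let red_wedge12 w x : wedge12 (evf w) OmL = x%:E -> wedge12 (red w) Omega = x.[0].
Proof.
have -> : wedge12 (evf w) OmL = (\sum_i w i * (Omega 0 i)%:P)%:E.
  by rewrite rmorph_sum; apply: eq_bigr => i _; rewrite !mxE rmorphM /= evC.
move/ev0 <-; rewrite horner_sum; apply: eq_bigr => i _.
by rewrite mxE hornerM hornerC.
Qed.

(** Rescaling omega by g replaces alpha by alpha + dlog g = a'/c. At s = 0 the structure equation
    becomes c(0) d omega = a' /\ omega. If c(0) is nonzero this is (I). Otherwise the leading
    coefficient a' is parallel to omega, so it annihilates [Omega], and it is integrable by
    [closed_normal]. *)
Lemma transcendental_caseI : caseI_over T OmL -> caseI Omega.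
Proof.
move=> [o [a [[To Ta] oN0 oO ao ca]]].
have [g [w [Tg g0 gw wN0]]] := normalize1 To oN0.
pose a1 := dlog g + a.
have Ta1 : form1_over T a1.
  move=> i; rewrite !mxE; apply: (subfieldD dT.1) => //.
  by apply: (subfieldM dT.1); [apply: (subfieldV dT.1)|apply: dT.2].
have ca1 : d1 a1 = 0 by rewrite d1D d1_dlog ca addr0.
have dw : d1 (evf w) = wedge11 a1 (evf w).
  rewrite -gw d1Z -ao wedge11Dl wedge11Zr; congr (_ + _); last by rewrite wedge11Zr.
  by apply/rowP=> i; rewrite !mxE; field.
have wO : wedge12 (red w) Omega = 0.
  by rewrite (@red_wedge12 w 0) ?horner0 // -gw wedge12Zl oO mulr0 rmorph0.
have [c [a' [ca' c0 H]]] := closed_normal Ta1 ca1.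
have key : c.[0] *: d1 (red w) = wedge11 (red a') (red w).
  have /rowP h : c%:E *: d1 (evf w) = wedge11 (evf a') (evf w).
    by rewrite dw -ca' wedge11Zl.
  apply/rowP=> i; have := h i; rewrite mxE -evf_d1 -rmorphM.
  have -> : (wedge11 (evf a') (evf w)) 0 i =
     (a' (i + 1) * w (i + 2) - a' (i + 2) * w (i + 1))%:E.
    by rewrite !mxE rmorphB !rmorphM.
  by move/ev0; rewrite hornerM red_d1 => {}h; rewrite [LHS]mxE h hornerD hornerN !hornerM !mxE.
case: H => [[c00 cl]|[c00 a'N0 [g1 [cg1 dg1]]]].
  exists (red w), (c.[0]^-1 *: red a'); split=> //.
  by rewrite wedge11Zl -key scalerA mulVf // scale1r.
exists (red a'), g1; split=> //; apply: parallel_wedge12 wN0 wO.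
by rewrite -key c00 scale0r.
Qed.

(** Clearing the denominator c of beta and setting s = 0 gives a' /\ Omega = c(0) d Omega. Without a
    pole this is (II); with a pole the right side vanishes and a' is a form as in (I). *)
Lemma transcendental_caseII : caseII_over T OmL -> caseI Omega \/ caseII Omega.
Proof.
move=> [b [Tb db cb]]; have [c [a' [ca' c0 H]]] := closed_normal Tb cb.
have key : wedge12 (red a') Omega = c.[0] * d2 Omega.
  rewrite -(hornerC (d2 Omega) 0) -hornerM; apply: red_wedge12.
  by rewrite -ca' wedge12Zl -db map_d2 // rmorphM /= evC.
case: H => [[c00 cl]|[c00 a'N0 [g1 [cg1 dg1]]]].
  right; exists (c.[0]^-1 *: red a'); split=> //.
  by rewrite wedge12Zl key mulKf.
by left; exists (red a'), g1; split=> //; rewrite key c00 mul0r.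
Qed.

End TranscendentalStep.

(** * Finite steps *)

Section FormIdentities.
Variable L : diffFieldType.
Implicit Types (a u v : form1 L) (w : form2 L).

Lemma ord3_natE : (((0 + 1 = 1 :> 'I_3)%R * (0 + 2 = 2 :> 'I_3)%R) *
  ((1 + 1 = 2 :> 'I_3)%R * (1 + 2 = 0 :> 'I_3)%R) *
  ((2 + 1 = 0 :> 'I_3)%R * (2 + 2 = 1 :> 'I_3)%R))%type.
Proof. by do !split; apply/val_inj. Qed.

Lemma wedge12_wedge11 a u v : wedge12 v (wedge11 a u) = wedge12 a (wedge11 u v).
Proof. by rewrite /wedge12 !big_ord3 !mxE !ord3_natE; ring. Qed.

Lemma wedge12_wedge11_self a u : wedge12 u (wedge11 a u) = 0.
Proof. by rewrite /wedge12 !big_ord3 !mxE !ord3_natE; ring. Qed.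

Lemma wedge12_wedge11_selfl a u : wedge12 u (wedge11 u a) = 0.
Proof. by rewrite /wedge12 !big_ord3 !mxE !ord3_natE; ring. Qed.

Lemma wedge11C u v : wedge11 u v = - wedge11 v u.
Proof. by apply/rowP=> i; rewrite !mxE; ring. Qed.

Lemma wedge11Dr u v a : wedge11 a (u + v) = wedge11 a u + wedge11 a v.
Proof. by apply/rowP=> i; rewrite !mxE; ring. Qed.

Lemma d2_wedge11 u v : d2 (wedge11 u v) = wedge12 v (d1 u) - wedge12 u (d1 v).
Proof.
by rewrite /d2 /wedge12 !big_ord3 !mxE !ord3_natE !raddfB /= !derM; ring.
Qed.

Lemma wedge12Dr a w w' : wedge12 a (w + w') = wedge12 a w + wedge12 a w'.
Proof. by rewrite /wedge12 -big_split; apply: eq_bigr=> i _; rewrite mxE mulrDr. Qed.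

Lemma d1Z_const c a : constants c -> d1 (c *: a) = c *: d1 a.
Proof.
move=> c0; rewrite d1Z; apply/rowP=> i.
by rewrite [LHS]mxE [X in X + _]mxE !mxE !c0 !mul0r subrr add0r.
Qed.

Lemma constants_nat n : constants (n%:R : L).
Proof. by move=> i; apply: der_nat. Qed.

Lemma constantsV (c : L) : constants c -> constants c^-1.
Proof. by move=> c0 i; rewrite derV c0 mul0r oppr0. Qed.

Lemma constantsN (c : L) : constants c -> constants (- c).
Proof. by move=> c0 i; rewrite raddfN /= c0 oppr0. Qed.

End FormIdentities.

(** The action of the vector field P d/dx + Q d/dy + R d/dz that corresponds to the 2-form with
    coordinates P, Q, R. *)
Definition vder (L : diffFieldType) (w : form2 L) (x : L) : L := wedge12 (d0 x) w.

Lemma vder_is_zmod_morphism (L : diffFieldType) (w : form2 L) : zmod_morphism (vder w).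
Proof.
move=> x y; rewrite /vder /wedge12 -sumrB; apply: eq_bigr => i _.
by rewrite !mxE raddfB mulrBl.
Qed.

HB.instance Definition _ (L : diffFieldType) (w : form2 L) :=
  GRing.isZmodMorphism.Build L L (vder w) (@vder_is_zmod_morphism L w).

Lemma vderM (L : diffFieldType) (w : form2 L) x y :
  vder w (x * y) = vder w x * y + x * vder w y.
Proof.
rewrite /vder /wedge12 mulr_suml mulr_sumr -big_split; apply: eq_bigr => i _.
by rewrite !mxE derM /=; ring.
Qed.

Lemma deriv_map_additive (k : nzRingType) (D : {additive k -> k}) (p : {poly k}) :
  (map_poly D p)^`() = map_poly D p^`().
Proof. by apply/polyP=> i; rewrite coef_map !coef_deriv coef_map /= raddfMn. Qed.

(* If [f] solves the Riccati equation [D f = A + B f + C f^2] and [p] is its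
   characteristic polynomial, then [p^D + p' (A + B X + C X^2)] is a linear
   multiple of [p]; differentiating gives the logarithmic derivative of the
   different [p'(f)]. *)
Section Riccati.
Variables (k L : fieldType) (e : {rmorphism k -> L}).
Variables (D : {additive k -> k}) (D' : {additive L -> L}).
Hypothesis DM : forall x y, D (x * y) = D x * y + x * D y.
Hypothesis DM' : forall x y, D' (x * y) = D' x * y + x * D' y.
Hypothesis De : forall x, D' (e x) = e (D x).
Variables (f : L) (A B C s : k) (M : nat) (p : {poly k}).
Hypothesis Df : D' f = e A + e B * f + e C * f ^+ 2.
Hypothesis indep : forall q : {poly k}, (size q <= M.+2)%N -> ev e f q = 0 -> q = 0.
Hypotheses (pm : p \is monic) (sp : size p = M.+3) (ps : p`_M.+1 = - s) (ep : ev e f p = 0).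

Lemma riccati_different : D' (ev e f p^`()) = ev e f p^`() *
  (e (M%:R * C) * f + e (M.+1%:R * B + s * C)).
Proof.
have D1 : D 1 = 0.
  by apply: (addrI (D 1)); have := DM 1 1; rewrite !mulr1 mul1r addr0 => <-.
pose N : {poly k} := M.+2%:R.
pose q2 := A%:P + B%:P * 'X + C%:P * 'X ^+ 2.
(* The linear cofactor: with N = M + 2 the degree of [p] and [s] the sum of its roots, comparing the
   coefficients of X^(N+1) and X^N in p^D + p' q2 and q1 p leaves no other choice. *)
pose q1 := N * C%:P * 'X + N * B%:P + s%:P * C%:P.
pose G := map_poly D p + p^`() * q2 - q1 * p.
pose r := p - 'X^(M.+2) + s%:P * 'X^(M.+1).
have sr : (size r <= M.+1)%N.
  apply/leq_sizeP => j; rewrite leq_eqVlt => /orP [/eqP <-|].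
    rewrite !coefD coefN coefCM !coefXn eqxx ltn_eqF // ps /=; ring.
  rewrite leq_eqVlt => /orP [/eqP <-|jM].
    rewrite !coefD coefN coefCM !coefXn eqxx gtn_eqF // -[M.+2]/(M.+3.-1) -{1}sp -lead_coefE.
    by rewrite (monicP pm) /=; ring.
  have pj : p`_j = 0 by apply/(leq_sizeP p M.+3); rewrite ?sp.
  by rewrite !coefD coefN coefCM !coefXn pj (gtn_eqF jM) (gtn_eqF (ltnW jM)) /=; ring.
have pE : p = 'X^(M.+2) - s%:P * 'X^(M.+1) + r by rewrite /r; ring.
have dpE : p^`() = N * 'X * 'X^M - (M.+1%:R * s%:P) * 'X^M + r^`().
  rewrite {1}pE derivD derivB mul_polyC derivZ !derivXn /= -mul_polyC.
  rewrite -['X^(M.+1) *+ _]mulr_natl -['X^M *+ _]mulr_natl exprS.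
  by rewrite -/N; ring.
have DpE : map_poly D p = map_poly D r - (D s)%:P * 'X^(M.+1).
  rewrite {1}pE !raddfD raddfN /=.
  have -> : map_poly D 'X^(M.+2) = 0.
    by apply/polyP=> i; rewrite coef_map coefXn coef0; case: (i == _); rewrite /= ?D1 ?raddf0.
  have -> : map_poly D (s%:P * 'X^(M.+1)) = (D s)%:P * 'X^(M.+1).
    apply/polyP=> i; rewrite coef_map !coefCM coefXn.
    by case: (i == _); rewrite /= ?mulr1 ?mulr0 ?raddf0.
  by rewrite add0r addrC.
have GE : G = map_poly D r - (D s)%:P * 'X^(M.+1) +
    (N * A%:P - M.+1%:R * s%:P * B%:P + s%:P * (N * B%:P + s%:P * C%:P)) * 'X^(M.+1)
    - (M.+1%:R * s%:P * A%:P) * 'X^M + r^`() * q2 - q1 * r.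
  rewrite /G DpE dpE {1}pE /q2 /q1 /N !exprS -[M.+2%:R]natr1; ring.
(* [G] vanishes at [f], since there p^D + p' q2 is the derivative of p(f) = 0. The choice of [q1]
   brings its degree below N, so independence of the lower powers of [f] applies. *)
have G0 : G = 0.
  apply: indep; last first.
    rewrite rmorphB rmorphD !rmorphM /= ep mulr0 subr0.
    have -> : ev e f q2 = D' f.
      by rewrite Df /q2 !rmorphD !rmorphM /= !evC evX; ring.
    by rewrite !evE -(der_horner (D' := D')) // -evE ep raddf0.
  have sPX (c : k) j : (j <= M.+1)%N -> (size (c%:P * 'X^j)%R <= M.+2)%N.
    by move=> jM; rewrite mul_polyC (leq_trans (size_scale_leq _ _)) // size_polyXn.
  have sD (a b : {poly k}) : (size a <= M.+2)%N -> (size b <= M.+2)%N -> (size (a + b)%R <= M.+2)%N.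
    by move=> ha hb; rewrite (leq_trans (size_polyD _ _)) // geq_max ha hb.
  have sN (a : {poly k}) : (size a <= M.+2)%N -> (size (- a)%R <= M.+2)%N by rewrite size_polyN.
  have sC (c : k) : (size c%:P <= 1)%N by exact: size_polyC_leq1.
  have Nn n : n%:R = (n%:R)%:P :> {poly k} by rewrite polyC_natr.
  rewrite GE /N !Nn -!(polyCM, polyCD, polyCN).
  apply: (sD); first apply: (sD); first apply: (sD); first apply: (sD); first apply: (sD).
  - by rewrite (leq_trans (size_poly _ _)) // (leq_trans sr).
  - by apply/sN/sPX.
  - exact: sPX.
  - by apply/sN/sPX.
  - have [->|r0] := eqVneq r^`() 0; first by rewrite mul0r size_poly0.
    have rn0 : r != 0 by apply: contraNneq r0 => ->; rewrite linear0.
    have sr' : (size r^`() <= M)%N by rewrite -ltnS (leq_trans (lt_size_deriv rn0)).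
    rewrite (leq_trans (size_polyMleq _ _)) //.
    have : (size q2 <= 3)%N.
      rewrite /q2 (leq_trans (size_polyD _ _)) // geq_max; apply/andP; split.
        rewrite (leq_trans (size_polyD _ _)) // geq_max (leq_trans (sC _)) //=.
        by rewrite mul_polyC (leq_trans (size_scale_leq _ _)) // size_polyX.
      by rewrite mul_polyC (leq_trans (size_scale_leq _ _)) // size_polyXn.
    by move=> sq; have := leq_add sr' sq; rewrite addn3; case: (_ + _)%N.
  - apply: sN; have sq : (size q1 <= 2)%N.
      rewrite /q1 /N !Nn -!polyCM -addrA -polyCD (leq_trans (size_polyD _ _)) // geq_max.
      rewrite mul_polyC (leq_trans (size_scale_leq _ _)) ?size_polyX //=.
      exact: leq_trans (sC _) _.
    rewrite (leq_trans (size_polyMleq _ _)) //.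
    by have := leq_add sq sr; rewrite add2n; case: (_ + _)%N.
have Eq2 : ev e f q2 = D' f by rewrite Df /q2 !rmorphD !rmorphM /= !evC evX; ring.
have Eq2' : ev e f q2^`() = e B + 2%:R * e C * f.
  rewrite /q2 !derivD derivC add0r !mul_polyC !derivZ derivX derivXn /= -!mul_polyC.
  by rewrite !rmorphD !rmorphM rmorphMn /= !evC evX rmorph1; ring.
have Eq1 : ev e f q1 = M.+2%:R * (e C * f + e B) + e s * e C.
  by rewrite /q1 /N !rmorphD !rmorphM /= !evC evX rmorph_nat; ring.
(* The X-derivative of G = 0 at [f] reads D'(p'(f)) + p'(f) q2'(f) = q1(f) p'(f), the term with p(f)
   dropping out. *)
have /(congr1 (fun q => ev e f q^`())) : G = 0 := G0.
rewrite /G linear0 rmorph0; move: Eq2 Eq2' Eq1; clear GE G0 G; clearbody q1 q2 => Eq2 Eq2' Eq1.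
rewrite derivB derivD !derivM deriv_map_additive !(rmorphB, rmorphD, rmorphM) /= ep mulr0 add0r.
rewrite Eq2 Eq2' Eq1 => /eqP; rewrite subr_eq0 addrA => /eqP H.
rewrite evE (der_horner (D' := D') (D := D)) // -!evE.
apply: (addIr (ev e f p^`() * (e B + 2%:R * e C * f))).
rewrite H !rmorph_nat -!natr1; ring.
Qed.

End Riccati.

Section FiniteStep.
Variables (k L : diffFieldType) (e : {rmorphism k -> L}) (T : set L).
Hypothesis he : forall i x, der i (e x) = e (der i x).

Definition trace_map (tau : L -> k) :=
  [/\ forall x y, T x -> T y -> tau (x + y) = tau x + tau y,
      forall c x, T x -> tau (e c * x) = c * tau x,
      forall c, tau (e c) = c &
      forall i x, T x -> tau (der i x) = der i (tau x)].

Hypothesis dT : diff_subfield T.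
Hypothesis eT : forall c, T (e c).
Variable tau : L -> k.
Hypothesis htau : trace_map tau.

Let sT : subfield T := dT.1.

Definition trace_form (a : form1 L) : form1 k := \row_i tau (a 0 i).

Lemma trace0 : tau 0 = 0.
Proof. by case: htau => _ _ tc _; rewrite -(rmorph0 e) tc. Qed.

Lemma traceN x : T x -> tau (- x) = - tau x.
Proof.
by case: htau => _ tZ _ _ Tx; rewrite -mulN1r -(rmorphN1 e) tZ // mulN1r.
Qed.

Lemma traceB x y : T x -> T y -> tau (x - y) = tau x - tau y.
Proof.
move=> Tx Ty; case: (htau) => tD _ _ _; rewrite tD ?traceN //; exact: subfieldN.
Qed.

Lemma trace_sum n (F : 'I_n -> L) : (forall i, T (F i)) ->
  tau (\sum_i F i) = \sum_i tau (F i).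
Proof.
move=> TF; case: (htau) => tD _ _ _; elim: n F TF => [|n IH] F TF.
  by rewrite !big_ord0 trace0.
by rewrite !big_ord_recl tD ?IH //; apply: (subfield_sum sT).
Qed.

Lemma traceZr x c : T x -> tau (x * e c) = tau x * c.
Proof. by case: htau => _ tZ _ _ Tx; rewrite mulrC tZ // mulrC. Qed.

Lemma trace_form_d1 a : form1_over T a -> d1 (trace_form a) = trace_form (d1 a).
Proof.
move=> Ta; case: (htau) => _ _ _ td; apply/rowP=> i; rewrite !mxE traceB ?td //.
  exact: dT.2.
exact: dT.2.
Qed.

Lemma trace_form_closed a : form1_over T a -> d1 a = 0 -> d1 (trace_form a) = 0.
Proof.
move=> Ta ca; rewrite trace_form_d1 // ca; apply/rowP=> i.
by rewrite !mxE trace0.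
Qed.

Lemma trace_form_wedge12 a w : form1_over T a ->
  wedge12 (trace_form a) w = tau (wedge12 a (map_mx e w)).
Proof.
move=> Ta; rewrite /wedge12 trace_sum.
  by apply: eq_bigr => i _; rewrite !mxE traceZr.
by move=> i; rewrite mxE; apply: (subfieldM sT).
Qed.

Lemma trace_form_wedge11 a b : form1_over T a ->
  wedge11 (trace_form a) b = trace_form (wedge11 a (map_mx e b)).
Proof.
move=> Ta; apply/rowP=> i; rewrite !mxE traceB ?traceZr //; exact: (subfieldM sT).
Qed.

Lemma trace_form_map a : trace_form (map_mx e a) = a.
Proof. by case: htau => _ _ tc _; apply/rowP=> i; rewrite !mxE tc. Qed.

Lemma trace_caseII (Omega : form2 k) : caseII_over T (map_mx e Omega) -> caseII Omega.
Proof.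
move=> [b [Tb db cb]]; exists (trace_form b); split; last exact: trace_form_closed.
by case: htau => _ _ tc _; rewrite trace_form_wedge12 // -db map_d2 // tc.
Qed.

End FiniteStep.

(** Where the i-th coordinate of [Om] is nonzero, solving for the i-th coordinate of an annihilating
    form leaves two free ones. The frame is defined over [K], but the expansion holds over every
    extension, with coefficients that are coordinates of [w] scaled from [K]; they stay in any
    subfield containing these. *)
Lemma form1_frame (K : diffFieldType) (Om : form2 K) : Om != 0 ->
  exists u v : form1 K, wedge11 u v = Om /\
   forall (L : diffFieldType) (e : {rmorphism K -> L}) (w : form1 L),
     wedge12 w (map_mx e Om) = 0 -> exists i j (c d : K),
     w = (w 0 i * e c) *: map_mx e u + (w 0 j * e d) *: map_mx e v.
Proof.
move=> OmN0.
have [i Oi] : exists i, Om 0 i != 0.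
  apply/existsP; rewrite -negb_forall; apply: contraNN OmN0 => /forallP h.
  by apply/eqP/rowP=> i; rewrite mxE; apply/eqP.
have n01 : (i + 1 == i) = false by rewrite -[X in _ == X]addr0 (inj_eq (addrI i)).
have n02 : (i + 2 == i) = false by rewrite -[X in _ == X]addr0 (inj_eq (addrI i)).
have n12 : (i + 1 == i + 2) = false by rewrite (inj_eq (addrI i)).
have simp := (ord3_addE, n01, n02, n12, eqxx, eq_sym i, eq_sym (i + 2) (i + 1)).
pose E j : form1 K := delta_mx 0 j.
exists (E (i + 1) - (Om 0 (i + 1) / Om 0 i) *: E i),
       (Om 0 i *: E (i + 2) - Om 0 (i + 2) *: E i); split.
  apply/rowP; apply: (ord3_cycle (i := i)); rewrite !mxE !simp /=; by field.
move=> L e w; rewrite /wedge12 (sum_cycle _ i) !mxE => wO.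
have eO : e (Om 0 i) != 0 by rewrite fmorph_eq0.
have wi : w 0 i = - (w 0 (i + 1) * e (Om 0 (i + 1)) + w 0 (i + 2) * e (Om 0 (i + 2))) / e (Om 0 i).
  by apply: (mulIf eO); rewrite divfK //; apply/eqP; rewrite -addr_eq0 addrA wO.
exists (i + 1), (i + 2), 1, (Om 0 i)^-1.
apply/rowP; apply: (ord3_cycle (i := i)); rewrite !mxE !simp /= ?wi;
  rewrite !(rmorphB, rmorphM, rmorph1, rmorph0, fmorphV, rmorphN) /=; by field.
Qed.

(* Two conjugates [u + f_1 v], [u + f_2 v] of an algebraic form would give
   [d Omega = (alpha_1 + alpha_2 - dlog (f_1 - f_2)) ^ Omega]; averaging over
   all pairs of conjugates produces the trace of [alpha] and the discriminant of
   [f], i.e. the norm of the different [p'(f)]. *)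
Lemma simple_algebraic_step (k L : diffFieldType) (e : {rmorphism k -> L})
  (he : forall i x, der i (e x) = e (der i x)) (ch : char0 L)
  (f : L) (u v : form1 k) (a : form1 L) :
  let w := map_mx e u + f *: map_mx e v in
  algebraic e f -> form1_over (adjoin (range e) f) a -> wedge11 u v != 0 ->
  wedge11 a w = d1 w -> d1 a = 0 ->
  caseI (wedge11 u v) \/ caseII (wedge11 u v).
Proof.
move=> w algf Ta uv0 aw ca; set Om := wedge11 u v in uv0 *.
pose T := adjoin (range e) f.
have dT : diff_subfield T by exact: algebraic_diff.
have eT c : T (e c) by apply: adjoin_base; exists c.
have Tf : T f by exact: adjoin_gen.
have evT p : T (ev e f p) by apply/adjoinP; exists p, 1; rewrite rmorph1 oner_neq0 divr1.
have [n [p0 [_ _ indep spanp]]] := algebraic_basis algf.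
pose b (j : 'I_n.+1) := f ^+ j.
have ev_sum (q : {poly k}) : (size q <= n.+1)%N -> ev e f q = \sum_(j < n.+1) e q`_j * b j.
  move=> sq; rewrite evE (horner_coef_wide _ (_ : _ <= n.+1)%N); last first.
    by rewrite size_map_poly.
  by apply: eq_bigr => j _; rewrite coef_map.
have sb : spans e T b.
  split=> [j|x /adjoinP /spanp [q sq ->]]; first exact: (subfieldX dT.1).
  by exists (fun j => q`_j); rewrite ev_sum.
have ib : independent e b.
  move=> c c0 j; have := indep (\poly_(i < n.+1) c (inord i)) (size_poly _ _).
  rewrite ev_sum ?size_poly // => H.
  have /polyP /(_ j) : \poly_(i < n.+1) c (inord i) = 0.
    by apply: H; rewrite -[RHS]c0; apply: eq_bigr => i _; rewrite coef_poly ltn_ord inord_val.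
  by rewrite coef_poly ltn_ord inord_val coef0.
have [tau [tD tZ tC td tp]] := normalized_trace he dT eT ch sb ib.
have htau : trace_map e T tau by [].
have uvL : wedge11 (map_mx e u) (map_mx e v) = map_mx e Om by rewrite map_wedge11.
have dw : d1 w = map_mx e (d1 u) + (wedge11 (d0 f) (map_mx e v) + f *: map_mx e (d1 v)).
  by rewrite d1D d1Z !map_d1.
pose A := wedge12 u (d1 u); pose a0 := wedge12 v (d1 u).
pose b0 := wedge12 u (d1 v); pose C := wedge12 v (d1 v).
have alX : wedge12 a (map_mx e Om) = e a0 + f * e C.
  rewrite -uvL -wedge12_wedge11; have /(congr1 (wedge12 (map_mx e v))) := aw.
  rewrite dw wedge11Dr wedge11Zr !wedge12Dr !wedge12Zr !map_wedge12.
  by rewrite !wedge12_wedge11_self mulr0 addr0 add0r.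
have Df : vder (map_mx e Om) f = e A + e (a0 + b0) * f + e C * f ^+ 2.
  have /(congr1 (wedge12 (map_mx e u))) := aw.
  rewrite dw wedge11Dr wedge11Zr !wedge12Dr !wedge12Zr !map_wedge12.
  have hU c : wedge12 (map_mx e u) (wedge11 c (map_mx e v)) = - wedge12 c (map_mx e Om).
    by rewrite wedge12_wedge11 wedge11C uvL -scaleN1r wedge12Zr mulN1r.
  rewrite wedge12_wedge11_self !hU -/(vder _ _) alX add0r => H.
  have -> : vder (map_mx e Om) f = e A + f * e b0 + f * (e a0 + f * e C).
    by apply/eqP; rewrite -subr_eq0 -[f * (e a0 + _)]opprK -mulrN H -/A -/b0; apply/eqP; ring.
  by rewrite rmorphD; ring.
have dOm : d2 Om = a0 - b0 by rewrite d2_wedge11.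
have [p [pm sp pn ep]] := tp f Tf.
(* In degree one [f] lies in [k] and [w] is already defined there, which gives (I). Otherwise the
   degree is M + 2. *)
case: n => [|M] in p0 b indep spanp ev_sum sb ib tp p pm sp pn ep *.
  have [q sq fq] := spanp f ((adjoinP e f f).1 Tf).
  have [c fc] : exists c, f = e c.
    by exists q`_0; rewrite [LHS]fq (size1_polyC sq) evC coefC.
  left; exists (u + c *: v), (trace_form tau a).
  have wE : w = map_mx e (u + c *: v) by rewrite map_mxD map_mxZ -fc.
  split.
  - apply: contraNneq uv0 => uc0.
    have -> : Om = wedge11 (u + c *: v) v by rewrite wedge11Dl wedge11Zl wedge11_self scaler0 addr0.
    by rewrite uc0; apply/eqP/rowP=> i; rewrite !mxE; ring.
  - by rewrite wedge12Dl wedge12Zl wedge12_wedge11_self wedge12_wedge11_selfl mulr0 addr0.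
  - by rewrite (trace_form_wedge11 dT eT htau) // -wE aw wE map_d1 // (trace_form_map htau).
  - exact: (trace_form_closed dT htau).
right.
have N0 : M.+2%:R != 0 :> k by apply: char0_nat => //; apply: (char0_domain e ch).
have N1 : M.+1%:R != 0 :> k by apply: (char0_domain e ch).
pose h := ev e f p^`().
have h0 : h != 0.
  apply/negP => /eqP /indep; have chk := char0_domain e ch.
  rewrite size_deriv_char0 // sp /= leqnn => /(_ isT) /eqP.
  by rewrite -size_poly_eq0 size_deriv_char0 // sp.
have Th : T h by apply: evT.
have Tdh : form1_over T (dlog h).
  move=> i; rewrite !mxE; apply: (subfieldM dT.1); first exact: (subfieldV dT.1).
  exact: dT.2.
have De x : vder (map_mx e Om) (e x) = e (vder Om x).
  by rewrite /vder map_d0 // map_wedge12.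
have ps : p`_M.+1 = - (M.+2%:R * tau f) by rewrite -mulNr -pn.
have Dh := riccati_different (vderM Om) (vderM (map_mx e Om)) De Df indep pm sp ps ep.
(* The average over the N (N - 1) ordered pairs of conjugates, N = M + 2: that of alpha_1 + alpha_2
   is twice the normalized trace, that of dlog (f_1 - f_2) is the normalized trace of dlog p'(f)
   divided by N - 1. *)
exists (2%:R *: trace_form tau a - M.+1%:R^-1 *: trace_form tau (dlog h)).
split; last first.
  rewrite -scaleNr d1D !d1Z_const.
  - by rewrite !(trace_form_closed dT htau) ?d1_dlog // !scaler0 addr0.
  - exact/constantsN/constantsV/constants_nat.
  - exact: constants_nat.
rewrite -scaleN1r wedge12Dl !wedge12Zl !(trace_form_wedge12 dT eT htau) // alX.
have -> : wedge12 (dlog h) (map_mx e Om) =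
    e (M%:R * C) * f + e (M.+1%:R * (a0 + b0) + M.+2%:R * tau f * C).
  by rewrite /dlog wedge12Zl -/(vder _ _) Dh mulKf.
have TM c : T (e c * f) by apply: (subfieldM dT.1).
rewrite (mulrC f) !tD // !tZ // !tC dOm; field.
by rewrite addrC natr1.
Qed.

Section FiniteDescent.
Variables (k L : diffFieldType) (e : {rmorphism k -> L}) (T : set L).
Hypothesis he : forall i x, der i (e x) = e (der i x).
Hypothesis ch : char0 L.
Hypothesis dT : diff_subfield T.
Hypothesis eT : forall c, T (e c).
Variables (n : nat) (b : 'I_n -> L).
Hypothesis sb : spans e T b.

(* The trace from [T] to [k(f)] brings [alpha] down to [k(f)], the field of
   definition of the normalized form [u + f v]. *)
Lemma finite_step_normalized (f : L) (u v : form1 k) (a : form1 L) :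
  let w := map_mx e u + f *: map_mx e v in
  T f -> form1_over T a -> wedge11 u v != 0 -> wedge11 a w = d1 w -> d1 a = 0 ->
  caseI (wedge11 u v) \/ caseII (wedge11 u v).
Proof.
move=> w Tf Ta uv0 aw ca.
have algf : algebraic e f.
  have [m [b' [sb' ib]]] := spans_basis sb.
  have [tau [_ _ _ _ tp]] := normalized_trace he dT eT ch sb' ib.
  by have [p [pm _ _ ep]] := tp f Tf; exists p => //; apply: monic_neq0.
have dT0 := algebraic_diff he ch algf.
have [k0 [e0 [he0 re0]]] := diff_subfieldP dT0.
have T0T x : adjoin (range e) f x -> T x.
  by apply: adjoin_min => //; [exact: dT.1|move=> _ [c _ <-]].
have e0T c : T (e0 c) by apply: T0T; rewrite -re0; exists c.
have sb0 : spans e0 T b.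
  split=> [|x Tx]; first exact: sb.1.
  have [c ->] := sb.2 x Tx.
  have H j : exists d, e0 d = e (c j).
    have : range e0 (e (c j)) by rewrite re0; apply: adjoin_base; exists (c j).
    by move=> [d _ <-]; exists d.
  by have [d hd] := choice H; exists d; apply: eq_bigr => j _; rewrite hd.
have [m [b' [sb' ib]]] := spans_basis sb0.
have [tau [tD tZ tC td _]] := normalized_trace he0 dT e0T ch sb' ib.
have htau : trace_map e0 T tau by [].
have [w0 wE] : exists w0, w = map_mx e0 w0.
  apply/form1_overP => i; rewrite re0 !mxE; apply: (subfieldD dT0.1).
    by apply: adjoin_base; exists (u 0 i).
  apply: (subfieldM dT0.1); first exact: adjoin_gen.
  by apply: adjoin_base; exists (v 0 i).
apply: (@simple_algebraic_step _ _ e he ch f u v (map_mx e0 (trace_form tau a))) => //.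
- by rewrite -re0; apply/form1_overP; exists (trace_form tau a).
- rewrite -/w wE map_wedge11 map_d1 // (trace_form_wedge11 dT e0T htau) // -wE aw wE.
  by rewrite map_d1 // (trace_form_map htau).
- by rewrite map_d1 // (trace_form_closed dT htau) // map_mx0.
Qed.

(** Dividing omega by one of its frame coefficients z, which changes alpha into alpha - dlog z,
    brings it to the shape u + f v with f in [T]. *)
Lemma finite_caseI (Omega : form2 k) :
  caseI_over T (map_mx e Omega) -> caseI Omega \/ caseII Omega.
Proof.
move=> [o [a [[To Ta] oN0 oO ao ca]]].
have [->|OmN0] := eqVneq Omega 0.
  right; exists 0; split.
    rewrite /d2 /wedge12 !big1 // => i _; rewrite !mxE ?mul0r ?raddf0 //.
  by apply/rowP=> i; rewrite !mxE !raddf0 ?addr0.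
have [u [v [uv fr]]] := form1_frame OmN0.
have [i [j [c [d oE]]]] := fr L e o oO.
pose x := o 0 i * e c; pose y := o 0 j * e d.
have Tx : T x by apply: (subfieldM dT.1).
have Ty : T y by apply: (subfieldM dT.1).
have norm z : T z -> z != 0 -> exists a1, [/\ form1_over T a1, d1 a1 = 0 &
    wedge11 a1 (z^-1 *: o) = d1 (z^-1 *: o)].
  move=> Tz z0; exists (a - dlog z); split.
  - move=> l; rewrite !mxE; apply: (subfieldB dT.1) => //.
    by apply: (subfieldM dT.1); [apply: (subfieldV dT.1)|apply: dT.2].
  - rewrite -scaleN1r d1D ca d1Z_const ?d1_dlog ?scaler0 ?addr0 //.
    exact/constantsN/(@constants_nat _ 1).
  - rewrite d1Z -ao wedge11Dl -scaleN1r; apply/rowP=> l.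
    by rewrite !mxE !derV; field.
have [x0|x0] := eqVneq x 0; last first.
  have [a1 [Ta1 ca1 aw1]] := norm x Tx x0.
  have wE : x^-1 *: o = map_mx e u + (y / x) *: map_mx e v.
    by rewrite {1}oE -/x -/y scalerDr !scalerA mulVf // scale1r (mulrC y).
  rewrite -uv; apply: (finite_step_normalized (f := y / x) (a := a1)) => //.
  - exact: (subfield_div dT.1).
  - by rewrite uv.
  - by rewrite -wE.
have y0 : y != 0.
  by apply: contraNneq oN0 => y0; rewrite oE -/x -/y x0 y0 !scale0r addr0.
have [a1 [Ta1 ca1 aw1]] := norm y Ty y0.
(* With no u-component, the frame (v, -u) represents the same 2-form and puts omega in normalized
   shape with f = 0. *)
have wE : y^-1 *: o = map_mx e v + 0 *: map_mx e (- u).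
  by rewrite {1}oE -/x -/y x0 scale0r add0r scalerA mulVf // scale1r scale0r addr0.
have uv' : wedge11 v (- u) = Omega by rewrite -uv; apply/rowP=> l; rewrite !mxE; ring.
rewrite -uv'; apply: (finite_step_normalized (f := 0) (a := a1)) => //.
- exact: (subfield0 dT.1).
- by rewrite uv'.
- by rewrite -wE.
Qed.

Lemma finite_descent (Omega : form2 k) :
  caseI_over T (map_mx e Omega) \/ caseII_over T (map_mx e Omega) ->
  caseI Omega \/ caseII Omega.
Proof.
move=> [/finite_caseI //|H]; right.
have [m [b' [sb' ib]]] := spans_basis sb.
have [tau [tD tZ tC td _]] := normalized_trace he dT eT ch sb' ib.
by apply: (trace_caseII he dT eT (tau := tau)).
Qed.

End FiniteDescent.

(** * Descent along the tower *)

Lemma algebraic_spans (k L : diffFieldType) (e : {rmorphism k -> L}) (t : L) :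
  algebraic e t -> exists n (b : 'I_n -> L), spans e (adjoin (range e) t) b.
Proof.
move=> /algebraic_basis [n [p [_ _ _ spanp]]]; exists n.+1, (fun j => t ^+ j); split.
  by move=> j; apply: (subfieldX (adjoin_subfield _ _)); apply: adjoin_gen.
move=> x /adjoinP /spanp [q sq ->]; exists (fun j => q`_j).
rewrite evE (horner_coef_wide _ (_ : _ <= n.+1)%N) ?size_map_poly //.
by apply: eq_bigr => j _; rewrite coef_map.
Qed.

Lemma liouvillian_step_descent (L : diffFieldType) (S T : set L) (Omega : form2 L) :
  char0 L -> diff_subfield S -> diff_subfield T -> liouvillian_step S T ->
  form1_over S Omega ->
  caseI_over T Omega \/ caseII_over T Omega -> caseI_over S Omega \/ caseII_over S Omega.
Proof.
move=> ch dS dT step OS HT.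
have [k [e [he re]]] := diff_subfieldP dS; rewrite -{}re in dS step OS *.
have /form1_overP [Om0 OE] := OS; rewrite {}OE in HT *.
rewrite caseI_map // caseII_map //.
(* Only a transcendental generator can be specialized at s = 0; an algebraic one makes the step
   finite. *)
have trans s (eta : 'I_3 -> {poly k}) : T = adjoin (range e) s ->
    (forall i, der i s = s * ev e s (eta i)) -> caseI Om0 \/ caseII Om0.
  move=> TE ds; rewrite TE in HT dT.
  have [alg|nalg] := pselect (algebraic e s).
    have [n [b sb]] := algebraic_spans alg.
    by apply: (finite_descent he ch dT _ sb) => // c; apply: adjoin_base; exists c.
  case: HT => [/(transcendental_caseI he nalg ds)|/(transcendental_caseII he nalg ds)] //.
  by left.
case: step => [[t [a [TE t0 /form1_overP [a0 aE] ta]]]|[t [a [TE /form1_overP [a0 aE] ta]]]|[ST [n [b [Tb sb]]]]].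
- apply: (trans t (fun i => (a0 0 i)%:P)) => // i.
  by move/rowP: ta => /(_ i); rewrite aE !mxE evC.
(* If dt = a, then s = 1/t satisfies ds = - a s^2, so eta = - a s. *)
- apply: (trans t^-1 (fun i => - ((a0 0 i)%:P * 'X))); first by rewrite adjoinV.
  move=> i; move/rowP: ta => /(_ i); rewrite aE !mxE derV => ->.
  by rewrite rmorphN rmorphM /= evC evX expr2 invfM; ring.
- have sb' : spans e T b.
    split=> // x /sb [c [Sc ->]].
    have H j : exists d, e d = c j by have [d _ <-] := Sc j; exists d.
    by have [d hd] := choice H; exists d; apply: eq_bigr => j _; rewrite hd.
  by apply: (finite_descent he ch dT _ sb') => // c; apply: ST; exists c.
Qed.

Lemma liouvillian_first_integral_cases (K : diffFieldType) (Omega : form2 K) :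
  char0 K -> has_liouvillian_first_integral Omega -> caseI Omega \/ caseII Omega.
Proof.
move=> ch [L [phi [[_ [m [F [F0 Fm dF stepF]]]] [phiN0 phiO]]]].
have chL : char0 L by apply: (char0_codomain (emb L)).
have OF0 : form1_over (F 0) (lift2 L Omega).
  by rewrite F0; apply/form1_overP; exists Omega.
have FS i : (i <= m)%N -> form1_over (F i) (lift2 L Omega).
  elim: i => [|i IH] im //; have Fi := IH (ltnW im); have [_ dF'] := dF _ im.
  have sub x : F i x -> F i.+1 x.
    case: (stepF i im) => [[t [a [-> _ _ _]]]|[t [a [-> _ _]]]|[ST _]]; last exact: ST.
      exact: adjoin_base.
    exact: adjoin_base.
  by move=> j; apply: sub.
have top : caseI_over (F m) (lift2 L Omega).
  exists (d0 phi), 0; rewrite Fm; split => //.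
  - apply/eqP => /rowP H; apply: phiN0 => i; have := H i; rewrite !mxE //.
  - by rewrite d1_d0; apply/rowP=> i; rewrite !mxE; ring.
  - by apply/rowP=> i; rewrite !mxE !raddf0 ?addr0.
have H j : (j <= m)%N -> caseI_over (F (m - j)%N) (lift2 L Omega) \/
    caseII_over (F (m - j)%N) (lift2 L Omega).
  elim: j => [|j IH] jm; first by rewrite subn0; left.
  have mj : (m - j = (m - j.+1).+1)%N by rewrite subnSK.
  apply: (@liouvillian_step_descent _ _ (F (m - j)%N)) => //.
  - exact/dF/leq_subr.
  - exact/dF/leq_subr.
  - by rewrite mj; apply: stepF; rewrite -mj leq_subr.
  - exact/FS/leq_subr.
  - exact/IH/ltnW.
have := H m (leqnn m); rewrite subnn F0 /lift2.
by rewrite caseI_map ?caseII_map //; apply: emb_der.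
Qed.

(** * Closed forms over C(x,y,z) *)

Section Irreducible.
Variable k : fieldType.
Implicit Types (p q pi : {poly k}).

Lemma irreducible_dvdM pi p q : irreducible_poly pi -> pi %| p * q -> (pi %| p) || (pi %| q).
Proof.
move=> irr; have [//|nd] := boolP (pi %| p).
by rewrite Gauss_dvdpr // irreducible_poly_coprime.
Qed.

Lemma exists_irreducible q : (1 < size q)%N -> exists2 pi, irreducible_poly pi & pi %| q.
Proof.
have [n] := ubnP (size q); elim: n q => // n IH q sq q1.
have [irr|nirr] := pselect (irreducible_poly q); first by exists q.
have [d [d1 dq ndq]] : exists d : {poly k}, [/\ size d != 1%N, d %| q & ~~ (d %= q)].
  apply: contrapT => h; apply: nirr; split=> // d d1 dq; apply: contrapT => /negP ndq.
  by apply: h; exists d.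
have q0 : q != 0 by rewrite -size_poly_gt0 ltnW.
have sd : (size d < size q)%N.
  rewrite ltn_neqAle dvdp_leq // andbT; apply: contraNneq ndq => sdq.
  by rewrite -dvdp_size_eqp // sdq.
have d0 : d != 0 by apply: contraTneq dq => ->; rewrite dvd0p.
have d2 : (1 < size d)%N by rewrite ltn_neqAle eq_sym d1 size_poly_gt0.
have [pi irr pid] := IH d (leq_trans sd sq) d2.
by exists pi => //; apply: dvdp_trans dq.
Qed.

Lemma irreducible_factor q pi : irreducible_poly pi -> q != 0 ->
  exists m (q1 : {poly k}), q = q1 * pi ^+ m /\ ~~ (pi %| q1).
Proof.
move=> irr; have [s1 _] := irr.
have [n] := ubnP (size q); elim: n q => // n IH q sq q0.
have [/dvdpP [q1 qE]|nd] := boolP (pi %| q); last by exists 0%N, q; rewrite mulr1.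
have q10 : q1 != 0 by apply: contraNneq q0; rewrite qE => ->; rewrite mul0r.
have sq1 : (size q1 < n)%N.
  rewrite -ltnS (leq_trans _ sq) // ltnS qE size_mul ?(irredp_neq0 irr) //.
  by rewrite -subn1 ltn_subRL addnC ltn_add2l.
have [m [q2 [q1E nd]]] := IH q1 sq1 q10.
by exists m.+1, q2; split=> //; rewrite qE q1E exprSr mulrA.
Qed.

(** If pi has degree n, the n + 1 powers 1, c, ..., c^n are linearly dependent modulo pi; a kernel
    vector of their coefficient matrix supplies [P]. *)
Lemma annihilating_poly pi c : pi != 0 -> exists2 P, P != 0 & pi %| P \Po c.
Proof.
move=> pi0; pose n := (size pi).-1.
have spi : size pi = n.+1 by rewrite /n prednK // size_poly_gt0.
pose A : 'M[k]_(n.+1, n) := \matrix_(i, j) ((c ^+ i) %% pi)`_j.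
have : kermx A != 0.
  rewrite -mxrank_eq0 mxrank_ker -lt0n subn_gt0 ltnS; exact: rank_leq_col.
move=> /matrix0Pn [i [j kij]]; pose v := row i (kermx A).
have vA : v *m A = 0 by rewrite -row_mul mulmx_ker row0.
exists (\poly_(m < n.+1) v 0 (inord m)).
  apply/eqP => /polyP /(_ j); rewrite coef_poly ltn_ord inord_val coef0 mxE => h.
  by rewrite h eqxx in kij.
rewrite poly_def linear_sum /=.
rewrite (eq_bigr (fun m : 'I_n.+1 => v 0 m *: (c ^+ m %/ pi) * pi + v 0 m *: (c ^+ m %% pi))).
  rewrite big_split /= -mulr_suml [X in _ + X](_ : _ = 0) ?addr0 ?dvdp_mull //.
  apply/polyP=> l; rewrite coef_sum coef0; have [ln|nl] := ltnP l n.
    move/rowP: vA => /(_ (Ordinal ln)); rewrite !mxE => vA; apply: etrans vA.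
    by apply: eq_bigr => m _; rewrite coefZ !mxE.
  apply: big1 => m _; rewrite coefZ (leq_sizeP _ n _) ?mulr0 //.
  by have := ltn_modp (c ^+ m) pi; rewrite pi0 spi ltnS => ->.
move=> m _; rewrite inord_val linearZ /= comp_Xn_poly {1}(divp_eq (c ^+ m) pi).
by rewrite scalerDr scalerAl.
Qed.

End Irreducible.

(** Algebraic closedness of the field of constants, phrased with polynomials over [k] so that no
    separate type of constants is needed. *)
Definition closed_constants (k : diffFieldType) := forall P : {poly k},
  (1 < size P)%N -> (forall i, constants P`_i) -> exists2 r : k, constants r & root P r.

Definition logsum (L : diffFieldType) (l : seq (L * L)) : form1 L :=
  \sum_(x <- l) x.1 *: dlog x.2.

(* The [j0]-th derivation is [d/dt] on [k(t)], and the other derivations kill [t]. *)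
Section RationalIntegration.
Variables (k L : diffFieldType) (e : {rmorphism k -> L}).
Hypothesis he : forall i x, der i (e x) = e (der i x).
Variables (t : L) (j0 : 'I_3).
Hypothesis Dk : forall c : k, der j0 c = 0.
Hypothesis Dt : forall i, der i t = (i == j0)%:R.
Hypothesis ch : char0 L.
Hypothesis cc : closed_constants k.

Local Notation T := (adjoin (range e) t).
Local Notation "p %:E" := (ev e t p) (at level 2, format "p %:E").
Implicit Types (p q a b pi : {poly k}).

Let chk : char0 k := char0_domain e ch.
Let sT : subfield T := adjoin_subfield _ _.

Let Dp i p : {poly k} := map_poly (der i) p + (i == j0)%:R *: p^`().

Let derE i p : der i p%:E = (Dp i p)%:E.
Proof. by rewrite der_ev // Dt rmorphD /= evZ rmorph_nat mulrC. Qed.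

Let DE p : der j0 p%:E = p^`()%:E.
Proof.
rewrite derE /Dp eqxx scale1r (_ : map_poly _ p = 0) ?add0r //.
by apply/polyP=> i; rewrite coef_map /= Dk coef0.
Qed.

(** As d/dt kills [k], differentiating a minimal relation for [t] would give a shorter one. *)
Lemma rational_transcendental : ~ algebraic e t.
Proof.
move=> /algebraic_basis [n [p [sp ep small _]]].
have : p^`() = 0.
  apply: small; last by rewrite -DE ep raddf0.
  by rewrite size_deriv_char0 // sp.
by move/eqP; rewrite -size_poly_eq0 size_deriv_char0 // sp.
Qed.
Let nt := rational_transcendental.

Let evI p q : p%:E = q%:E -> p = q. Proof. exact: ev_inj. Qed.
Let TE p : T p%:E.
Proof. by apply/adjoinP; exists p, 1; rewrite rmorph1 oner_neq0 divr1. Qed.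
Let E0 p : (p%:E == 0) = (p == 0). Proof. exact: ev_eq0. Qed.

Let dT : diff_subfield T.
Proof. by apply: adjoin_diff => // i; rewrite Dt; apply: subfield_nat. Qed.

(** For a reduced fraction a/b with derivative zero, a' b = a b' forces b to divide b', so b is
    constant; then a' = 0. *)
Lemma rational_constant x : T x -> der j0 x = 0 -> range e x.
Proof.
move=> /adjoin_reduced_fraction [a [b [cop bm b0 ->]]].
rewrite der_div // !DE => /eqP; rewrite mulf_eq0 invr_eq0 expf_eq0 /= (negPf b0) orbF.
rewrite subr_eq0 -!rmorphM => /eqP /evI E.
have : b %| b^`() by rewrite -(Gauss_dvdpr _ cop) -E dvdp_mull.
have bN0 := monic_neq0 bm; move=> /dvdp_leq; rewrite size_deriv_char0 // => H.
have sb : size b = 1%N.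
  have := bN0; rewrite -size_poly_gt0; case: (size b) H (size_deriv_char0 b chk) => [|[|n]] //= H sd _.
  by have := H; rewrite -size_poly_gt0 sd => /(_ isT); rewrite ltnn.
have [c c0 bc] : exists2 c, c != 0 & b = c%:P by apply/size_poly1P; rewrite sb.
move: E; rewrite bc derivC mulr0 => /eqP; rewrite mulf_eq0 polyC_eq0 (negPf c0) orbF.
rewrite -size_poly_eq0 size_deriv_char0 // => sa.
have /size1_polyC -> : (size a <= 1)%N by case: (size a) sa => [|[]].
by rewrite !evC -fmorph_div; exists (a`_0 / c).
Qed.

Let irr_deriv pi : irreducible_poly pi -> ~~ (pi %| pi^`()).
Proof.
move=> [s1 _]; apply/negP => /dvdp_leq.
rewrite -size_poly_gt0 size_deriv_char0 //.
by case: (size pi) s1 => [|[|n]] //= _ /(_ isT); rewrite ltnn.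
Qed.

(** A derivative has no simple pole: a pole of order m > 0 becomes one of order m + 1, because the
    new leading coefficient - m g pi' is prime to pi in characteristic zero. *)
Let simple_pole pi (w r s : {poly k}) x : irreducible_poly pi -> ~~ (pi %| s) -> T x ->
  w%:E / pi%:E + r%:E / s%:E = der j0 x -> pi %| w.
Proof.
move=> irr nds /adjoinP [g0 [h0 [h00 xE]]].
have piN0 := irredp_neq0 irr; have piE0 : pi%:E != 0 by rewrite E0.
have sN0 : s != 0 by apply: contraNneq nds => ->; rewrite dvdp0.
have sE0 : s%:E != 0 by rewrite E0.
pose P m := `[< exists g h : {poly k}, ~~ (pi %| h) /\ x = g%:E / (pi%:E ^+ m * h%:E) >].
have exP : exists m, P m.
  have h0N0 : h0 != 0 by rewrite -E0.
  have [m [h [hE nd]]] := irreducible_factor irr h0N0.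
  by exists m; apply/asboolP; exists g0, h; rewrite xE hE rmorphM rmorphXn /= [h%:E * _]mulrC.
case: (ex_minnP exP) => m /asboolP [g [h [ndh {}xE]]] mmin.
have hN0 : h != 0 by apply: contraNneq ndh => ->; rewrite dvdp0.
have hE0 : h%:E != 0 by rewrite E0.
have dpi := irr_deriv irr.
case: m mmin xE => [|m] mmin xE.
  rewrite xE expr0 mul1r der_div // !DE => /eqP.
  have -> : w%:E / pi%:E + r%:E / s%:E = (w%:E * s%:E + r%:E * pi%:E) / (pi%:E * s%:E).
    by field; rewrite piE0 sE0.
  rewrite eqr_div ?mulf_neq0 ?expf_neq0 // => /eqP H.
  have {}H : (w * s + r * pi) * h ^+ 2 = (g^`() * h - g * h^`()) * (pi * s).
    by apply: evI; rewrite !(rmorphXn, rmorphB, rmorphM, rmorphD) /=.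
  have : pi %| w * (s * h ^+ 2).
    have -> : w * (s * h ^+ 2) = ((g^`() * h - g * h^`()) * s - r * h ^+ 2) * pi.
      have -> : w * (s * h ^+ 2) = (w * s + r * pi) * h ^+ 2 - r * h ^+ 2 * pi by ring.
      by rewrite H; ring.
    exact: dvdp_mull.
  by rewrite expr2; do 3 (move=> /(irreducible_dvdM irr) /orP [//|]; rewrite ?(negPf nds) ?(negPf ndh) //).
have ndg : ~~ (pi %| g).
  apply/negP => /dvdpP [g1 gE]; have /mmin : P m; last by rewrite ltnn.
  apply/asboolP; exists g1, h; split=> //; rewrite xE gE rmorphM exprS /=.
  by field; rewrite piE0 hE0 expf_neq0.
rewrite xE der_div ?mulf_neq0 ?expf_neq0 // derM derX !DE => /eqP.
have -> : w%:E / pi%:E + r%:E / s%:E = (w%:E * s%:E + r%:E * pi%:E) / (pi%:E * s%:E).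
  by field; rewrite piE0 sE0.
rewrite eqr_div ?mulf_neq0 ?expf_neq0 ?mulf_neq0 ?expf_neq0 // => /eqP H.
have {}H : (w * s + r * pi) * (pi ^+ m.+1 * h) ^+ 2 =
    (g^`() * (pi ^+ m.+1 * h) -
     g * (m.+1%:R * pi ^+ m * pi^`() * h + pi ^+ m.+1 * h^`())) * (pi * s).
  by apply: evI; rewrite !(rmorphXn, rmorphB, rmorphM, rmorphD, rmorph_nat) /=.
have {}H : (w * s + r * pi) * pi ^+ m.+1 * h ^+ 2 =
    (g^`() * pi * h - m.+1%:R * g * pi^`() * h - g * h^`() * pi) * s.
  apply: (mulIf (expf_neq0 m.+1 piN0)); move: H; rewrite !exprS expr0 => H.
  transitivity ((w * s + r * pi) *
    (pi * pi ^+ m * h * (pi * pi ^+ m * h * 1))); first by ring.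
  by rewrite H; ring.
have : pi %| m.+1%:R *: (g * (pi^`() * (h * s))).
  have -> : m.+1%:R *: (g * (pi^`() * (h * s))) =
    ((g^`() * h - g * h^`()) * s - (w * s + r * pi) * pi ^+ m * h ^+ 2) * pi.
    transitivity ((g^`() * h - g * h^`()) * s * pi - (w * s + r * pi) * pi ^+ m.+1 * h ^+ 2).
      by rewrite H -mul_polyC polyC_natr; ring.
    by rewrite exprS; ring.
  exact: dvdp_mull.
rewrite dvdpZr ?chk //.
by do 3 (move=> /(irreducible_dvdM irr) /orP []; rewrite ?(negPf nds) ?(negPf ndh) ?(negPf ndg) ?(negPf dpi) //).
Qed.

(** What closedness says about the coefficient [A] of index [j0] of a 1-form; [B] is then the
    coefficient of index [i]. *)
Let has_primitives A := forall i, exists B, T B /\ der i A = der j0 B.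

(* In k[X]/(pi) the residue [c] is killed by the derivations, so the coefficients
   of its minimal polynomial are constants, and it has a constant root. *)
Let residue_constant pi q1 (c p2 : {poly k}) : irreducible_poly pi -> ~~ (pi %| q1) ->
  (size c < size pi)%N -> has_primitives (c%:E * pi^`()%:E / pi%:E + p2%:E / q1%:E) ->
  exists2 c0, constants c0 & c = c0%:P.
Proof.
move=> irr ndq sc HA; have piN0 := irredp_neq0 irr.
have piE0 : pi%:E != 0 by rewrite E0.
have q1E0 : q1%:E != 0 by rewrite E0; apply: contraNneq ndq => ->; rewrite dvdp0.
(* Up to terms regular at pi, subtracting the [j0]-derivative of c D_i(pi) / pi from the
   [i]-derivative of c pi' / pi cancels the double poles and leaves this numerator over pi. For [i]
   other than [j0], its quotient by pi' is the derivative of the class of [c] in k[X]/(pi). *)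
have Dw i : pi %| Dp i c * pi^`() - c^`() * Dp i pi.
  have [B [TB dB]] := HA i.
  apply: (@simple_pole pi _ (Dp i p2 * q1 - p2 * Dp i q1) (q1 ^+ 2)
           (B - c%:E * (Dp i pi)%:E / pi%:E)) => //.
  - by rewrite expr2; apply/negP => /(irreducible_dvdM irr); rewrite (negPf ndq).
  - apply: (subfieldB sT) => //; apply: (subfield_div sT) => //.
    exact: (subfieldM sT).
  rewrite [RHS]raddfB /= -dB !(rmorphXn, rmorphB, rmorphM) /= -!DE -!derE raddfD /=.
  rewrite !der_div // !derM [der i (der j0 _)]der_comm.
  by field; rewrite piE0 q1E0.
pose Q n := `[< exists P : {poly k}, [/\ P != 0, size P = n & pi %| P \Po c] >].
have exQ : exists n, Q n.
  by have [P P0 dP] := annihilating_poly c piN0; exists (size P); apply/asboolP; exists P.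
case: (ex_minnP exQ) => n /asboolP [P1 [P10 sP1 dP1]] nmin.
have small (P : {poly k}) : (size P < n)%N -> pi %| P \Po c -> P = 0.
  move=> sP dP; apply/eqP; apply/negP => /negP P0.
  by have /nmin : Q (size P); [apply/asboolP; exists P|rewrite leqNgt sP].
pose P := (lead_coef P1)^-1 *: P1.
have lc0 : (lead_coef P1)^-1 != 0 by rewrite invr_eq0 lead_coef_eq0.
have sP : size P = n by rewrite size_scale.
have dP : pi %| P \Po c by rewrite comp_polyZ dvdpZr.
have P0 : P != 0 by rewrite scaler_eq0 negb_or lc0.
have Pm : lead_coef P = 1 by rewrite lead_coefZ mulVf // -invr_eq0.
have n1 : (1 < n)%N.
  rewrite -sP ltnNge; apply/negP => /size1_polyC PC; move: dP P0.
  rewrite PC comp_polyC => dP; rewrite polyC_eq0 => c0; have [s1 _] := irr.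
  have := dvdp_leq _ dP; rewrite polyC_eq0 => /(_ c0).
  by rewrite size_polyC c0 leqNgt s1.
have Pconst i : map_poly (der i) P = 0.
  apply: small.
    rewrite -sP; have sPn : size P = (size P).-1.+1 by rewrite prednK // size_poly_gt0.
    rewrite sPn ltnS; apply/leq_sizeP => j; rewrite leq_eqVlt => /orP [/eqP <-|jP].
      by rewrite coef_map -lead_coefE Pm /= der1.
    by rewrite coef_map /= nth_default ?raddf0 // sPn.
  have /dvdpP [h hE] := dP.
  have : pi %| (map_poly (der i) P \Po c) * pi^`().
    have -> : (map_poly (der i) P \Po c) * pi^`() =
      (Dp i h * pi^`() - h^`() * Dp i pi) * pi -
      (P^`() \Po c) * (Dp i c * pi^`() - c^`() * Dp i pi).
      apply: evI; rewrite rmorphM rmorphB !rmorphM !rmorphB !rmorphM /= !ev_comp -!DE -!derE.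
      have Vi := @der_ev k L e c%:E he i P; have Vj := @der_ev k L e c%:E he j0 P.
      have M0 : map_poly (der j0) P = 0.
        by apply/polyP=> l; rewrite coef_map /= Dk coef0.
      rewrite M0 rmorph0 add0r -ev_comp hE in Vj; rewrite -ev_comp hE in Vi.
      rewrite !rmorphM !derM /= in Vi Vj.
      have -> : ev e c%:E (map_poly (der i) P) =
        der i h%:E * pi%:E + h%:E * der i pi%:E - ev e c%:E P^`() * der i c%:E.
        by rewrite Vi addrK.
      apply/eqP; rewrite -subr_eq0; apply/eqP.
      transitivity (der i pi%:E * (der j0 h%:E * pi%:E + h%:E * der j0 pi%:E
        - ev e c%:E P^`() * der j0 c%:E)); first by ring.
      by rewrite Vj subrr mulr0.
    by rewrite dvdp_sub ?dvdp_mull.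
  by move=> /(irreducible_dvdM irr) /orP [] //; rewrite (negPf (irr_deriv irr)).
have [r rc /factor_theorem [Q1 QE]] : exists2 r, constants r & root P r.
  apply: cc; first by rewrite sP.
  by move=> j i; have /polyP /(_ j) := Pconst i; rewrite coef_map coef0.
have Q10 : Q1 != 0 by apply: contraNneq P0; rewrite QE => ->; rewrite mul0r.
have sQ : (size Q1 < n)%N.
  by rewrite -sP QE size_Mmonic ?monicXsubC // size_XsubC addn2.
(* The cofactor [Q1] of X - r is too small to kill [c] modulo pi, so pi divides c - r, and the size
   of [c] makes the difference zero. *)
exists r => //; apply/eqP; rewrite -subr_eq0; apply/negP => /negP cr0.
move: dP; rewrite QE comp_polyM => /(irreducible_dvdM irr) /orP [/(small _ sQ)/eqP|].
  by rewrite (negPf Q10).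
rewrite comp_polyB comp_polyX comp_polyC => /(dvdp_leq cr0); have [s1 _] := irr.
rewrite leqNgt => /negP; apply; apply: leq_ltn_trans (size_polyD _ _) _.
rewrite gtn_max sc size_polyN; apply: leq_ltn_trans s1; exact: size_polyC_leq1.
Qed.

Let integrable A := exists r (l : seq (L * L)), [/\ T r,
  forall x, x \in l -> [/\ constants x.1, T x.2 & x.2 != 0] &
  A = der j0 r + logsum l 0 j0].

Let logsum_cons x (l : seq (L * L)) i :
  logsum (x :: l) 0 i = x.1 * (der i x.2 / x.2) + logsum l 0 i.
Proof. by rewrite /logsum big_cons !mxE [_^-1 * _]mulrC. Qed.

Let integrable_der A r : T r -> integrable (A - der j0 r) -> integrable A.
Proof.
move=> Tr [r' [l [Tr' hl AE]]]; exists (r + r'), l; split=> //.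
  exact: (subfieldD sT).
by rewrite raddfD /= -addrA -AE addrC subrK.
Qed.

Let integrable_log A c g : constants c -> T g -> g != 0 ->
  integrable (A - c * (der j0 g / g)) -> integrable A.
Proof.
move=> cc' Tg g0 [r [l [Tr hl AE]]]; exists r, ((c, g) :: l); split=> //.
  by move=> x; rewrite inE => /orP [/eqP -> //|/hl].
by rewrite logsum_cons addrCA -AE addrC subrK.
Qed.

Let has_primitives_der A r : T r -> has_primitives A -> has_primitives (A - der j0 r).
Proof.
move=> Tr HA i; have [B [TB dB]] := HA i; exists (B - der i r); split.
  by apply: (subfieldB sT) => //; apply: dT.2.
by rewrite !raddfB /= dB der_comm.
Qed.

Let has_primitives_log A c g : constants c -> (exists c0, c = e c0) -> T g -> g != 0 ->
  has_primitives A -> has_primitives (A - c * (der j0 g / g)).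
Proof.
move=> cc' [c0 cE] Tg g0 HA i; have [B [TB dB]] := HA i.
exists (B - c * (der i g / g)); split.
  apply: (subfieldB sT) => //; apply: (subfieldM sT).
    by apply: adjoin_base; exists c0.
  by apply: (subfield_div sT) => //; apply: dT.2.
rewrite !raddfB /= dB !derM !cc' !derV (der_comm i); ring.
Qed.

(** Induction on the size of the denominator, through an irreducible factor pi. A simple factor is
    removed by subtracting c0 dlog pi, whose residue c0 is constant; a multiple factor loses one
    power when the derivative of some u / pi^(m+1) is subtracted; a constant denominator leaves a
    polynomial. *)
Lemma rational_integration A : T A -> has_primitives A -> integrable A.
Proof.
move=> /adjoinP [a [q [q0 ->]]]; have {q0} : q != 0 by rewrite -E0.
have [n] := ubnP (size q); elim: n a q => // n IH a q sq q0 HA.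
have qE0 : q%:E != 0 by rewrite E0.
have [q1|q1] := leqP (size q) 1.
  have qC := size1_polyC q1; rewrite qC in q0 qE0 HA *.
  move: (q`_0) q0 qE0 {HA} => d; rewrite polyC_eq0 evC => d0 eqE0.
  (* The termwise primitive; its coefficient of index 0 is a division by 0, hence 0. *)
  pose b := \poly_(i < (size a).+1) (a`_i.-1 / i%:R / d).
  exists b%:E, [::]; split=> //; rewrite /logsum big_nil mxE addr0 DE.
  have -> : b^`() = d^-1 *: a.
    apply/polyP=> i; rewrite coef_deriv coefZ coef_poly ltnS /=.
    have [ia|ia] := ltnP i (size a); last by rewrite nth_default // mulr0 mul0rn.
    by rewrite -mulr_natr; field; rewrite d0 -[_ + _]/(1 + i%:R) addrC natr1 chk.
  by rewrite evZ fmorphV mulrC.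
have [pi irr pidq] := exists_irreducible q1; have [s1 _] := irr.
have [m [q2 [qE nd]]] := irreducible_factor irr q0.
have piN0 := irredp_neq0 irr; have piE0 : pi%:E != 0 by rewrite E0.
have q2N0 : q2 != 0 by apply: contraNneq nd => ->; rewrite dvdp0.
have q2E0 : q2%:E != 0 by rewrite E0.
case: m qE => [|m] qE; first by move: nd; rewrite qE mulr1 in pidq *; rewrite pidq.
have [[u0 u1] /= uu] : exists u : {poly k} * {poly k}, u.1 * pi + u.2 * (pi^`() * q2) = 1.
  apply/Bezout_eq1_coprimepP; rewrite coprimepMr.
  by rewrite !irreducible_poly_coprime // irr_deriv.
have sq' : (size (pi ^+ m * q2)%R < n)%N.
  rewrite -ltnS (leq_trans _ sq) // ltnS.
  have -> : q = pi ^+ m * q2 * pi by rewrite qE exprSr; ring.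
  have : pi ^+ m * q2 != 0 by rewrite mulf_neq0 ?expf_neq0.
  move: (pi ^+ m * q2) => r r0.
  by rewrite size_mul // -subn1 ltn_subRL addnC ltn_add2l.
have pmN0 : pi ^+ m * q2 != 0 by rewrite mulf_neq0 ?expf_neq0.
case: m qE sq' pmN0 => [|m] qE sq' pmN0.
  pose c := (a * u1) %% pi.
  have sc : (size c < size pi)%N by rewrite ltn_modp.
  have [a2 a2E] : exists a2 : {poly k}, a = c * pi^`() * q2 + pi * a2.
    exists (a * u0 + (a * u1 %/ pi) * pi^`() * q2).
    rewrite -[LHS]mulr1 -uu mulrDr mulrA.
    rewrite [X in _ + X](_ : _ = a * u1 * (pi^`() * q2)); last by ring.
    by rewrite [in LHS](divp_eq (a * u1) pi) /c; ring.
  have AE : a%:E / q%:E = c%:E * pi^`()%:E / pi%:E + a2%:E / q2%:E.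
    by rewrite a2E qE expr1 !(rmorphD, rmorphM) /=; field; rewrite piE0 q2E0.
  have [c0 c0c cE] : exists2 c0, constants c0 & c = c0%:P.
    by apply: (residue_constant irr nd sc (p2 := a2)); rewrite -AE.
  have ec0 : constants (e c0) by move=> i; rewrite he c0c rmorph0.
  have A2E : a%:E / q%:E - e c0 * (der j0 pi%:E / pi%:E) = a2%:E / (pi ^+ 0 * q2)%:E.
    by rewrite AE cE evC DE expr0 mul1r; ring.
  apply: (integrable_log (c := e c0) (g := pi%:E)) => //.
  rewrite A2E; apply: IH => //; rewrite -A2E; apply: has_primitives_log => //.
  by exists c0.
(* [u1] inverts pi' q2 modulo pi, so this [u] makes a + (m + 1) u pi' q2, the numerator modulo pi
   after subtraction, divisible by pi. *)
pose u := - (m.+1%:R^-1 *: (a * u1)).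
have [a2 a2E] : exists a2 : {poly k}, a + m.+1%:R * u * pi^`() * q2 - u^`() * pi * q2 = a2 * pi.
  exists (a * u0 - u^`() * q2).
  have uE : m.+1%:R * u = - (a * u1).
    by rewrite /u mulrN mulr_natl -scaler_nat scalerA divff ?chk // scale1r.
  transitivity (a * (u0 * pi + u1 * (pi^`() * q2)) + m.+1%:R * u * pi^`() * q2 - u^`() * pi * q2).
    by rewrite uu mulr1.
  by rewrite uE; ring.
have TB : T (u%:E / (pi ^+ m.+1)%:E) by apply: (subfield_div sT); apply: TE.
have A2E : a%:E / q%:E - der j0 (u%:E / (pi ^+ m.+1)%:E) = a2%:E / (pi ^+ m.+1 * q2)%:E.
  rewrite der_div ?E0 ?expf_neq0 // !rmorphXn /= derX !DE qE !(rmorphXn, rmorphM) /=.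
  have /(congr1 (ev e t)) := a2E; rewrite !(rmorphB, rmorphD, rmorphM, rmorph_nat) /= => H.
  transitivity ((a2%:E * pi%:E) / (q2%:E * pi%:E ^+ m.+2)).
    by rewrite -H !exprS; field; rewrite piE0 q2E0 expf_neq0.
  by rewrite !exprS; field; rewrite piE0 q2E0 expf_neq0.
apply: (integrable_der TB); rewrite A2E; apply: IH => //.
by rewrite -A2E; exact: has_primitives_der TB HA.
Qed.

End RationalIntegration.

Lemma closed_formP (L : diffFieldType) (a : form1 L) : d1 a = 0 ->
  forall i j, der i (a 0 j) = der j (a 0 i).
Proof.
move=> /rowP ca i; have E l : der (l + 1) (a 0 (l + 2)) = der (l + 2) (a 0 (l + 1)).
  by apply/eqP; rewrite -subr_eq0; have := ca l; rewrite !mxE => ->.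
apply: (ord3_cycle (P := fun j => der i (a 0 j) = der j (a 0 i)) (i := i)) => //.
  by have := E (i + 2); rewrite !ord3_addE => ->.
by have := E (i + 1); rewrite !ord3_addE => ->.
Qed.

Lemma d1_logsum (L : diffFieldType) (l : seq (L * L)) :
  (forall x, x \in l -> constants x.1) -> d1 (logsum l) = 0.
Proof.
rewrite /logsum; elim: l => [|x l IH] hl.
  by rewrite big_nil; apply/rowP=> i; rewrite !mxE !raddf0 ?addr0.
rewrite big_cons d1D d1Z_const ?d1_dlog ?scaler0 ?add0r ?IH //.
  by move=> y yl; apply: hl; rewrite inE yl orbT.
by apply: hl; rewrite inE eqxx.
Qed.

Section SetStep.
Variables (L : diffFieldType) (S : set L) (t : L) (j0 : 'I_3).
Hypothesis ch : char0 L.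
Hypothesis dS : diff_subfield S.
Hypothesis DS : forall c, S c -> der j0 c = 0.
Hypothesis Dt : forall i, der i t = (i == j0)%:R.

Lemma adjoin_constant x : adjoin S t x -> der j0 x = 0 -> S x.
Proof.
have [k [e [he re]]] := diff_subfieldP dS; rewrite -re => Tx Dx.
apply: (rational_constant he _ Dt ch) Dx => // c.
by apply: (fmorph_inj e); rewrite -he rmorph0; apply: DS; rewrite -re; exists c.
Qed.

Lemma adjoin_diff_subfield : diff_subfield (adjoin S t).
Proof.
have [k [e [he re]]] := diff_subfieldP dS; rewrite -re.
apply: (adjoin_diff he) => i; rewrite Dt; apply: subfield_nat; exact: adjoin_subfield.
Qed.

Hypothesis CS : forall c : L, constants c -> S c.
Hypothesis cc : closed_constants L.

(** Integrating the coefficient of index [j0] leaves a closed form b without that coefficient.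
    Closedness then makes every other coefficient of b killed by the [j0]-th derivation, so it lies
    in [S]. *)
Lemma closed_form_step (a : form1 L) : form1_over (adjoin S t) a -> d1 a = 0 ->
  exists r (l : seq (L * L)), [/\ adjoin S t r,
    forall x, x \in l -> [/\ constants x.1, adjoin S t x.2 & x.2 != 0],
    form1_over S (a - d0 r - logsum l) & (a - d0 r - logsum l) 0 j0 = 0].
Proof.
move=> Ta ca; have [k [e [he re]]] := diff_subfieldP dS.
have Dk (c : k) : der j0 c = 0.
  by apply: (fmorph_inj e); rewrite -he rmorph0; apply: DS; rewrite -re; exists c.
have cck : closed_constants k.
  move=> P sP cP; have [||r rc rP] := cc (P := map_poly e P).
  - by rewrite size_map_poly.
  - by move=> i j; rewrite coef_map /= he cP rmorph0.
  have [r' _ rE] : range e r by rewrite re; apply: CS.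
  exists r'; last by rewrite -(fmorph_root e) rE.
  by move=> i; apply: (fmorph_inj e); rewrite -he rE rc rmorph0.
have prim i : exists B, adjoin (range e) t B /\ der i (a 0 j0) = der j0 B.
  by exists (a 0 i); rewrite re; split; [apply: Ta|apply: closed_formP].
have Taj : adjoin (range e) t (a 0 j0) by rewrite re; apply: Ta.
have [r [l [Tr hl aE]]] := rational_integration he Dk Dt ch cck Taj prim.
rewrite re in Tr hl; exists r, l.
pose b := a - d0 r - logsum l.
have bj : b 0 j0 = 0 by rewrite !mxE aE; ring.
have cb : d1 b = 0.
  rewrite /b -!scaleN1r !d1D ca !d1Z_const ?d1_d0 ?d1_logsum ?scaler0 ?addr0 //.
  - by move=> x /hl [].
  - exact/constantsN/(@constants_nat _ 1).
  - exact/constantsN/(@constants_nat _ 1).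
have [sT dT] := adjoin_diff_subfield.
split=> // i; apply: adjoin_constant; last by rewrite (closed_formP cb) bj raddf0.
rewrite /b !mxE; apply: (subfieldB sT); first by apply: (subfieldB sT); [apply: Ta|apply: dT].
rewrite /logsum summxE big_seq; apply: (subfield_sum sT) => x /hl [xc Tx x0].
rewrite !mxE; apply: (subfieldM sT); first exact: adjoin_base (CS xc).
apply: (subfieldM sT); [exact: (subfieldV sT Tx)|exact: dT Tx].
Qed.

End SetStep.

(** * Constants and closed forms in three variables *)

Section RationalFunctions.
Variable C : closedFieldType.
Hypothesis chC : char0 C.
Local Notation K := (ratfun C).

Definition cst : {rmorphism C -> K} := @FracField.tofrac {mpoly C[3]} \o @mpolyC 3 C.

Lemma of_cstE c : of_cst c = cst c. Proof. by []. Qed.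

Lemma char0_ratfun : char0 K. Proof. exact: (char0_codomain cst). Qed.

Lemma der_of_poly i p : der i (of_poly p) = of_poly (mderiv i p) :> K.
Proof.
have -> : of_poly p = of_poly p / FracField.tofrac (1 : {mpoly C[3]}) :> K.
  by rewrite tofrac1 divr1.
rewrite [LHS](frac_derE (@mderivM _ _ i)) ?oner_neq0 //.
by rewrite mulr1 -mpolyC1 mderivC mulr0 subr0 mpolyC1 tofrac1 expr1n divr1.
Qed.

Lemma der_cst i c : der i (cst c) = 0.
Proof. by rewrite -of_cstE /of_cst der_of_poly mderivC /of_poly tofrac0. Qed.

Definition coordinate (j : 'I_3) : K := of_poly 'X_j.

Lemma der_coordinate i j : der i (coordinate j) = (i == j)%:R.
Proof.
rewrite der_of_poly mderivX mnm1E eq_sym; case: eqP => [->|_].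
  rewrite scale1r (_ : (_ - _)%MM = 0%MM); first by rewrite /of_poly mpolyX0 tofrac1.
  by apply/mnmP=> l; rewrite mnmBE subnn mnm0E.
by rewrite scale0r /of_poly tofrac0.
Qed.

(** The chain C, C(x), C(x,y), C(x,y,z), as subsets of one field, so that all of them share its
    three derivations. *)
Let S0 : set K := range cst.
Let S1 := adjoin S0 (coordinate 0).
Let S2 := adjoin S1 (coordinate 1).
Let S3 := adjoin S2 (coordinate 2).

Let sS0 : diff_subfield S0.
Proof.
split; last by move=> i _ [c _ <-]; exists 0; rewrite ?rmorph0 ?der_cst.
split; first by exists 1; rewrite ?rmorph1.
  by move=> _ _ [c _ <-] [d _ <-]; exists (c - d); rewrite ?rmorphB.
by move=> _ _ [c _ <-] [d _ <-]; exists (c / d); rewrite ?fmorph_div.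
Qed.

Let sS1 : diff_subfield S1. Proof. exact: adjoin_diff_subfield (der_coordinate^~ 0). Qed.
Let sS2 : diff_subfield S2. Proof. exact: adjoin_diff_subfield (der_coordinate^~ 1). Qed.

Let killed j : subfield [set x : K | der j x = 0].
Proof.
split=> [|x y /= Dx Dy|x y /= Dx Dy]; first by rewrite /= der1.
  by rewrite raddfB /= Dx Dy subrr.
by rewrite derM derV Dx Dy !mul0r oppr0 mulr0 addr0.
Qed.

Let kill0 j x : S0 x -> der j x = 0.
Proof. by move=> [c _ <-]; rewrite der_cst. Qed.

Let kill1 j x : j != 0 -> S1 x -> der j x = 0.
Proof.
move=> j0; apply: (adjoin_min (killed j)) => [y|]; first exact: kill0.
by rewrite /= der_coordinate (negPf j0).
Qed.

Let kill2 x : S2 x -> der 2 x = 0.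
Proof.
apply: (adjoin_min (killed 2)) => [y|]; first exact: kill1.
by rewrite /= der_coordinate.
Qed.

Let S3T x : S3 x.
Proof.
have s3 : subfield S3 by exact: adjoin_subfield.
have S3C c : S3 (cst c) by do 3 apply: adjoin_base; exists c.
have S3X j : S3 (coordinate j).
  apply: (ord3_cycle (P := fun j => S3 (coordinate j)) (i := 0)); rewrite ?add0r.
  - by apply: adjoin_base; apply: adjoin_base; apply: adjoin_gen.
  - by apply: adjoin_base; apply: adjoin_gen.
  - exact: adjoin_gen.
have S3p p : S3 (of_poly p).
  rewrite [p]mpolyE /of_poly rmorph_sum; apply: (subfield_sum s3) => m _ /=.
  rewrite -mul_mpolyC rmorphM; apply: (subfieldM s3); first exact: S3C.
  rewrite mpolyXE_id rmorph_prod /=; elim/big_ind: _ => [|a b|i _].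
  - exact: (subfield1 s3).
  - exact: (subfieldM s3).
  - rewrite rmorphXn; apply: (subfieldX s3); exact: S3X.
have [a [b [_ ->]]] := fracP x; apply: (subfield_div s3); exact: S3p.
Qed.

(** An element killed by d/dz, d/dy and d/dx drops from C(x,y,z) to C(x,y), to C(x), and to C. *)
Lemma constants_ratfun : @constants K = range cst.
Proof.
apply/seteqP; split=> [x cx|x Sx i]; last exact: kill0.
apply: (adjoin_constant char0_ratfun sS0 (@kill0 0) (der_coordinate^~ 0)) (cx 0).
apply: (adjoin_constant char0_ratfun sS1 (fun c => @kill1 1 c isT) (der_coordinate^~ 1)) (cx 1).
exact: (adjoin_constant char0_ratfun sS2 kill2 (der_coordinate^~ 2) (S3T x) (cx 2)).
Qed.

Lemma closed_constants_ratfun : closed_constants K.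
Proof.
move=> P sP cP.
have H i : exists c, cst c = P`_i.
  have : @constants K P`_i by exact: cP.
  by rewrite constants_ratfun => -[c _ <-]; exists c.
have [c hc] := choice H; pose p := \poly_(i < size P) c i.
have PE : P = map_poly cst p.
  apply/polyP=> i; rewrite coef_map coef_poly; case: ltnP => [_|sPi]; first exact: esym (hc i).
  by rewrite nth_default // rmorph0.
have /closed_rootP [r rP] : size p != 1.
  by move: sP; rewrite PE size_map_poly; case: eqP => // ->.
exists (cst r); last by rewrite PE fmorph_root.
by move=> i; rewrite der_cst.
Qed.

Lemma closed_form_logsum (a : form1 K) : d1 a = 0 ->
  exists r (l : seq (K * K)),
    (forall x, x \in l -> constants x.1 /\ x.2 != 0) /\ a = d0 r + logsum l.
Proof.
move=> ca.
have C0 (c : K) : constants c -> S0 c by rewrite constants_ratfun.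
have C1 (c : K) : constants c -> S1 c := fun cc => adjoin_base (C0 c cc).
have C2 (c : K) : constants c -> S2 c := fun cc => adjoin_base (C1 c cc).
have ccK := closed_constants_ratfun; have chK := char0_ratfun.
have closedB (b : form1 K) r (l : seq (K * K)) : d1 b = 0 ->
    (forall x, x \in l -> constants x.1) -> d1 (b - d0 r - logsum l) = 0.
  move=> cb hl; rewrite -!scaleN1r !d1D cb !d1Z_const ?d1_d0 ?d1_logsum ?scaler0 ?addr0 //.
    exact/constantsN/(@constants_nat _ 1).
  exact/constantsN/(@constants_nat _ 1).
have Ta : form1_over S3 a := fun i => S3T _.
have [r3 [l3 [_ h3 o3 z3]]] := closed_form_step chK sS2 kill2 (der_coordinate^~ 2) C2 ccK Ta ca.
set a2 := a - d0 r3 - logsum l3 in o3 z3.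
have c2 : d1 a2 = 0 by apply: closedB => // x /h3 [].
have [r2 [l2 [T2 h2 o2 z2]]] :=
  closed_form_step chK sS1 (fun c => @kill1 1 c isT) (der_coordinate^~ 1) C1 ccK o3 c2.
set a1 := a2 - d0 r2 - logsum l2 in o2 z2.
have c1 : d1 a1 = 0 by apply: closedB => // x /h2 [].
have [r1 [l1 [T1 h1 o1 z1]]] :=
  closed_form_step chK sS0 (@kill0 0) (der_coordinate^~ 0) C0 ccK o2 c1.
set a0 := a1 - d0 r1 - logsum l1 in o1 z1.
have logsum0 (l : seq (K * K)) i : (forall x, x \in l -> der i x.2 = 0) -> logsum l 0 i = 0.
  by move=> hl; rewrite /logsum summxE big_seq big1 // => x /hl h; rewrite !mxE h !mulr0.
(* The terms subtracted after the first integration live over C(x,y) and have no dz-coefficient, so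
   the one already removed does not reappear. *)
have z12 : a1 0 2 = 0.
  rewrite /a1 mxE mxE z3 !mxE logsum0 ?kill2 ?subr0 //.
  by move=> x /h2 [_ h _]; apply: kill2.
have S12 x : S1 x -> S2 x by exact: adjoin_base.
have a00 : a0 = 0.
  apply/rowP=> i; rewrite [RHS]mxE; move: i.
  apply: (ord3_cycle (i := 0)); rewrite ?add0r //.
    rewrite /a0 mxE mxE z2 !mxE logsum0 ?(@kill1 1) ?subr0 //.
    by move=> x /h1 [_ h _]; apply: kill1.
  have l0 x : x \in l1 -> der 2 x.2 = 0 by move=> /h1 [_ h _]; exact: kill2 (S12 _ h).
  by rewrite /a0 mxE mxE z12 !mxE (logsum0 _ _ l0) (kill2 (S12 _ T1)) !subr0.
exists (r1 + r2 + r3), (l1 ++ l2 ++ l3); split.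
  by move=> x; rewrite !mem_cat => /or3P [/h1|/h2|/h3] [].
have -> : a = a0 + (d0 r1 + logsum l1) + (d0 r2 + logsum l2) + (d0 r3 + logsum l3).
  by rewrite /a0 /a1 /a2; apply/rowP=> i; rewrite !mxE; ring.
rewrite a00 add0r /logsum !big_cat /= -/(logsum l1) -/(logsum l2) -/(logsum l3).
have -> : d0 (r1 + r2 + r3) = d0 r1 + d0 r2 + d0 r3 by apply/rowP=> i; rewrite !mxE !raddfD.
by apply/rowP=> i; rewrite !mxE; ring.
Qed.

Lemma closed_form_darboux (a : form1 K) : d1 a = 0 ->
  exists (f g : {mpoly C[3]}) n (fs : 'I_n -> {mpoly C[3]}) (c : 'I_n -> C),
    [/\ f != 0, forall j, fs j != 0 &
        a = d0 (of_poly g / of_poly f) + \sum_j of_cst (c j) *: dlog (of_poly (fs j))].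
Proof.
move=> /closed_form_logsum [r [l [hl ->]]].
have [g [f [f0 rE]]] := fracP r.
suff [n [fs [c [fs0 lE]]]] : exists n (fs : 'I_n -> {mpoly C[3]}) (c : 'I_n -> C),
    (forall j, fs j != 0) /\ logsum l = \sum_j of_cst (c j) *: dlog (of_poly (fs j)).
  by exists f, g, n, fs, c; split=> //; rewrite rE lE.
elim: l hl => [|[c h] l IH] hl.
  exists 0%N, (fun _ => 1), (fun _ => 0); split; first by move=> [].
  by rewrite /logsum big_nil big_ord0.
have [|n [fs [cs [fs0 lE]]]] := IH; first by move=> x xl; apply: hl; rewrite inE xl orbT.
have [/= cc h0] := hl (c, h) (mem_head _ _).
have [c' _ c'E] : range cst c by rewrite -constants_ratfun.
have [p [q [q0 hE]]] := fracP h.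
have p0 : p != 0 by apply: contraNneq h0 => p0; rewrite hE p0 tofrac0 mul0r.
(* The logarithm of p/q becomes two logarithms of polynomials, with coefficients c' and - c'. *)
exists n.+2, (fun j => if unlift ord0 j is Some j' then
                (if unlift ord0 j' is Some j'' then fs j'' else q) else p),
  (fun j => if unlift ord0 j is Some j' then
                (if unlift ord0 j' is Some j'' then cs j'' else - c') else c').
split.
  by move=> j; case: (unlift ord0 j) => // j'; case: (unlift ord0 j').
rewrite !big_ord_recl !unlift_none !liftK unlift_none /logsum big_cons /= -/(logsum l) lE.
have -> : dlog h = dlog (of_poly p : K) - dlog (of_poly q : K).
  rewrite hE -(dlogV (of_poly q : K)); apply: (@dlogM K); first by rewrite tofrac_eq0.
  by rewrite invr_eq0 tofrac_eq0.
have -> : of_cst (- c') = - c by rewrite of_cstE rmorphN /= -c'E.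
have -> : of_cst c' = c := c'E.
rewrite [in RHS](eq_bigr (fun j => of_cst (cs j) *: dlog (of_poly (fs j)))).
  by rewrite scalerBr scaleNr addrA.
by move=> j _; rewrite !liftK.
Qed.

End RationalFunctions.

(** * Extensions without new constants *)

Lemma closed_constants_ext (k L : diffFieldType) (e : {rmorphism k -> L}) :
  @constants L = (e @` @constants k)%classic -> closed_constants k -> closed_constants L.
Proof.
move=> cL cc P sP cP.
have H i : exists c, constants c /\ e c = P`_i.
  by have : @constants L P`_i := cP i; rewrite cL => -[c cc' <-]; exists c.
have [c hc] := choice H; pose p := \poly_(i < size P) c i.
have PE : P = map_poly e p.
  apply/polyP=> i; rewrite coef_map coef_poly; case: ltnP => [_|sPi].
    exact: esym (hc i).2.
  by rewrite (nth_default _ sPi); exact: esym (rmorph0 e).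
have [||r rc rP] := cc p; first by rewrite -(size_map_poly e) -PE.
  move=> i j; rewrite coef_poly; case: ltnP => _; last by rewrite raddf0.
  exact: (hc i).1.
exists (e r); last by rewrite PE fmorph_root.
have : @constants L (e r) by rewrite cL; exists r.
exact.
Qed.

(** The monic minimal polynomial of a constant has constant coefficients, since its coefficientwise
    derivative is a smaller relation. It therefore has a constant root r, and minimality leaves only
    X - r. *)
Lemma algebraic_constant (k L : diffFieldType) (e : {rmorphism k -> L}) (x : L) :
  (forall i y, der i (e y) = e (der i y)) -> closed_constants k ->
  algebraic e x -> constants x -> (e @` @constants k)%classic x.
Proof.
move=> he cc /algebraic_basis [n [p [sp ep small _]]] cx.
have p0 : p != 0 by rewrite -size_poly_gt0 sp.
pose q := (lead_coef p)^-1 *: p.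
have lc0 : (lead_coef p)^-1 != 0 by rewrite invr_eq0 lead_coef_eq0.
have sq : size q = n.+2 by rewrite size_scale.
have eq0 : ev e x q = 0 by rewrite evZ ep mulr0.
have ql : q`_n.+1 = 1.
  by rewrite coefZ -[n.+1]/(n.+2.-1) -sp -lead_coefE mulVf // -invr_eq0.
have qc i : map_poly (der i) q = 0.
  apply: small.
    apply/leq_sizeP => j; rewrite leq_eqVlt => /orP [/eqP <-|jn].
      by rewrite coef_map /= ql der1.
    by rewrite coef_map /= nth_default ?raddf0 ?sq.
  have := @der_ev k L e x he i q; rewrite eq0 raddf0 cx mulr0 addr0.
  by move=> <-.
have [||r rc /factor_theorem [Q qE]] := cc q; first by rewrite sq.
  by move=> j i; have /polyP /(_ j) := qc i; rewrite coef_map coef0.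
exists r => //; move: eq0; rewrite qE rmorphM rmorphB /= evX evC => /eqP.
rewrite mulf_eq0 subr_eq0 => /orP [/eqP eQ|/eqP -> //].
have Q0 : Q != 0 by apply: contraTneq isT => Q0; move: sq; rewrite qE Q0 mul0r size_poly0.
have sQ : (size Q <= n.+1)%N.
  by move: sq; rewrite qE size_Mmonic ?monicXsubC // size_XsubC addn2 => -[->].
by have /eqP := small Q sQ eQ; rewrite (negPf Q0).
Qed.

(** * Derivations on polynomial rings and the fields they generate *)

Section PolyDer.
Variables (L : diffFieldType) (delta : 'I_3 -> {poly L}).

(** The derivation of L[X] that extends the i-th one on [L] and sends X to [delta i]. *)
Definition pder i (p : {poly L}) : {poly L} := map_poly (der i) p + p^`() * delta i.

Lemma pderD i : {morph pder i : p q / p + q}.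
Proof. by move=> p q; rewrite /pder raddfD derivD /=; ring. Qed.

Lemma pderC i c : pder i c%:P = (der i c)%:P.
Proof. by rewrite /pder map_polyC derivC mul0r addr0. Qed.

Lemma pderX i : pder i 'X = delta i.
Proof.
rewrite /pder derivX mul1r (_ : map_poly _ _ = 0) ?add0r //.
by apply/polyP=> j; rewrite coef_map coefX coef0 /= der_nat.
Qed.

Lemma pderMX i p : pder i (p * 'X) = pder i p * 'X + p * delta i.
Proof.
rewrite /pder derivM derivX mulr1.
have -> : map_poly (der i) (p * 'X) = map_poly (der i) p * 'X.
  by apply/polyP=> j; rewrite coef_map !coefMX; case: j => [|j]; rewrite /= ?raddf0 ?coef_map.
by ring.
Qed.

Lemma pderCM i c p : pder i (c%:P * p) = (der i c)%:P * p + c%:P * pder i p.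
Proof.
rewrite /pder derivM derivC mul0r add0r mulrDr mulrA addrA; congr (_ + _).
by apply/polyP=> j; rewrite coef_map !(coefD, coefCM) coef_map /= derM.
Qed.

Lemma pderM i p q : pder i (p * q) = pder i p * q + p * pder i q.
Proof.
elim/poly_ind: p => [|p c IH].
  have p0 : pder i 0 = 0 by rewrite -polyC0 pderC raddf0.
  by rewrite mul0r p0 !mul0r addr0.
have -> : (p * 'X + c%:P) * q = p * q * 'X + c%:P * q by ring.
rewrite !pderD pderMX IH pderCM pderMX pderC; ring.
Qed.

Hypothesis delta_comm : forall i j, pder i (delta j) = pder j (delta i).

Lemma pder_comm i j p : pder i (pder j p) = pder j (pder i p).
Proof.
elim/poly_ind: p => [|p c IH]; first by rewrite -polyC0 !pderC der_comm.
have H a b : pder a (pder b (p * 'X + c%:P)) = pder a (pder b p) * 'X +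
    pder b p * delta a + (pder a p * delta b + p * pder a (delta b)) + (der a (der b c))%:P.
  by rewrite (pderD b) (pderMX b) (pderC b) (pderD a) (pderD a) (pderMX a) (pderM a) (pderC a).
by rewrite !H IH delta_comm der_comm; ring.
Qed.

Lemma pderB i : {morph pder i : p q / p - q}.
Proof. by move=> p q; rewrite /pder raddfB derivB /=; ring. Qed.

Lemma ev_poly_morphism (M : fieldType) (phi : {rmorphism {poly L} -> M})
    (e : {rmorphism L -> M}) p : (forall c, e c = phi c%:P) -> ev e (phi 'X) p = phi p.
Proof.
move=> eE; elim/poly_ind: p => [|p c IH]; first by rewrite !rmorph0.
by rewrite !rmorphD !rmorphM /= IH evX evC eE.
Qed.

Lemma fraction_extension : exists (M : diffExt L) (t : M),
  [/\ ~ algebraic (emb M) t, forall i, der i t = ev (emb M) t (delta i) &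
      adjoin (range (emb M)) t = [set: M]%classic].
Proof.
pose fder i := frac_der (pder i).
have fD i : {morph fder i : x y / x + y} := frac_derD (pderD i) (pderM i).
have fM i := frac_derM (pderM i).
have fC i j x : fder i (fder j x) = fder j (fder i x).
  exact: (frac_der_comm (pderB i) (pderB j) (pderM i) (pderM j) (pder_comm i j)).
pose M : diffFieldType := HB.pack {fraction {poly L}}
  (Field_isDifferential.Build {fraction {poly L}} fD fM fC).
pose phi : {rmorphism {poly L} -> M} := @FracField.tofrac {poly L}.
have der_phi i p : der i (phi p) = phi (pder i p).
  have -> : phi p = phi p / phi 1 by rewrite rmorph1 divr1.
  rewrite [LHS](frac_derE (pderM i)) ?oner_neq0 // mulr1.
  by rewrite -polyC1 pderC der1 polyC0 mulr0 subr0 polyC1 tofrac1 expr1n divr1.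
pose e : {rmorphism L -> M} := phi \o polyC.
have he i x : der i (e x) = e (der i x) by rewrite /e /= der_phi pderC.
have evE p : ev e (phi 'X) p = phi p by apply: ev_poly_morphism.
exists (DiffExt he), (phi 'X); split=> /=.
- by move=> [p p0]; rewrite evE => /eqP; rewrite tofrac_eq0 (negPf p0).
- by move=> i; rewrite der_phi pderX evE.
- apply/seteqP; split=> // x _; apply: (adjoinP e (phi 'X) x).2.
  have [a [b [b0 ->]]] := fracP x; exists a, b; rewrite !evE; split=> //.
  by rewrite tofrac_eq0.
Qed.

(** The ideal (pi) is stable under the derivations, which therefore pass to the field L[X]/(pi). *)
Lemma quotient_extension (pi : {poly L}) : pi \is monic -> irreducible_poly pi ->
  (forall i, pi %| pder i pi) -> exists (M : diffExt L) (t : M),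
  [/\ forall q, (ev (emb M) t q == 0) = (pi %| q),
      forall i, der i t = ev (emb M) t (delta i) &
      forall x : M, exists q, x = ev (emb M) t q].
Proof.
move=> pim irr dpi; have hI : monic_irreducible_poly pi by split.
pose phi : {rmorphism {poly L} -> {poly %/ pi with hI}} := in_qpoly pi.
have phiE p : val (phi p) = p %% pi :> {poly L}.
  by rewrite /= mk_monicE // modpE (monicP pim) expr1n invr1 scale1r.
have phiK (x : {poly %/ pi with hI}) : phi (val x) = x.
  apply: val_inj; rewrite phiE modp_small //.
  by apply: (leq_trans (size_mk_monic x)); rewrite (mk_monicE hI).
have phi0 q : (phi q == 0) = (pi %| q).
  by rewrite -(inj_eq val_inj) phiE.
pose qder (i : 'I_3) (x : {poly %/ pi with hI}) : {poly %/ pi with hI} :=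
  phi (pder i (val x)).
have qphi i p : qder i (phi p) = phi (pder i p).
  rewrite /qder phiE; apply/eqP; rewrite -subr_eq0 -rmorphB /= phi0 -pderB.
  have -> : p %% pi - p = - (p %/ pi) * pi by rewrite {2}(divp_eq p pi); ring.
  by rewrite pderM dvdp_add ?dvdp_mull.
have qD i : {morph qder i : x y / x + y}.
  by move=> x y; rewrite -(phiK x) -(phiK y) -rmorphD !qphi pderD rmorphD.
have qM i x y : qder i (x * y) = qder i x * y + x * qder i y.
  by rewrite -(phiK x) -(phiK y) -rmorphM !qphi pderM rmorphD !rmorphM.
have qC i j x : qder i (qder j x) = qder j (qder i x).
  by rewrite -(phiK x) !qphi pder_comm.
pose M : diffFieldType := HB.pack {poly %/ pi with hI}
  (Field_isDifferential.Build {poly %/ pi with hI} qD qM qC).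
pose psi : {rmorphism {poly L} -> M} := phi.
pose e : {rmorphism L -> M} := psi \o polyC.
have he i x : der i (e x) = e (der i x).
  by rewrite -[LHS]/(qder i (phi x%:P)) qphi pderC.
have evE p : ev e (psi 'X) p = phi p by apply: ev_poly_morphism.
exists (DiffExt he), (psi 'X); split=> /=.
- by move=> q; rewrite evE; apply: phi0.
- by move=> i; rewrite -[LHS]/(qder i (phi 'X)) qphi pderX evE.
- by move=> x; exists (val x); rewrite evE; apply/esym/phiK.
Qed.

End PolyDer.

Lemma constants_map (k L : diffFieldType) (e : {rmorphism k -> L}) c :
  (forall i y, der i (e y) = e (der i y)) -> constants c -> constants (e c).
Proof. by move=> he cc i; rewrite he cc rmorph0. Qed.

Section RationalExtensionConstants.
Variables (L : diffFieldType) (delta : 'I_3 -> {poly L}) (M : diffFieldType).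
Variables (e : {rmorphism L -> M}) (t : M).
Hypothesis he : forall i y, der i (e y) = e (der i y).
Hypothesis nt : ~ algebraic e t.
Hypothesis dt : forall i, der i t = ev e t (delta i).
Hypothesis sdelta : forall i, (size (delta i) <= 2)%N.
Hypothesis adj : adjoin (range e) t = [set: M]%classic.

Local Notation pder := (pder delta).

Let derE i p : der i (ev e t p) = ev e t (pder i p).
Proof. by rewrite der_ev // dt /pder rmorphD rmorphM. Qed.

Let size_pder i p : (size (pder i p) <= size p)%N.
Proof.
rewrite /pder (leq_trans (size_polyD _ _)) // geq_max size_poly /=.
have [->|p0] := eqVneq p 0; first by rewrite linear0 mul0r size_poly0.
rewrite (leq_trans (size_polyMleq _ _)) //.
have := leq_add (lt_size_deriv p0) (sdelta i); rewrite addn2 addSn.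
by case: (_ + _)%N => //= m; rewrite !ltnS; apply: ltnW.
Qed.

(* The reduced denominator of a constant divides its derivatives, which have no
   larger degree. *)
Lemma constant_darboux_pair x : constants x -> exists a b,
  [/\ b \is monic, ev e t b != 0, x = ev e t a / ev e t b &
      forall i, exists l, pder i a = l *: a /\ pder i b = l *: b].
Proof.
move=> cx; have : adjoin (range e) t x by rewrite adj.
move=> /adjoin_reduced_fraction [a [b [cop bm b0 xE]]]; exists a, b; split=> // i.
have E : pder i a * b = a * pder i b.
  apply: (ev_inj nt); rewrite !rmorphM /= -!derE; apply/eqP; rewrite -subr_eq0.
  have := cx i; rewrite xE der_div // => /eqP.
  by rewrite mulf_eq0 invr_eq0 expf_eq0 /= (negPf b0) orbF.
have /dvdpP [l lE] : b %| pder i b by rewrite -(Gauss_dvdpr _ cop) -E dvdp_mull.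
have bN0 := monic_neq0 bm.
have /size1_polyC lC : (size l <= 1)%N.
  have [->|l0] := eqVneq l 0; first by rewrite size_poly0.
  have := size_pder i b; rewrite lE size_mul // leqNgt => H; rewrite leqNgt.
  apply: contra H => l1; rewrite -subn1 ltn_subRL ltn_add2r //.
exists l`_0; rewrite -!mul_polyC -lC; split=> //.
by apply: (mulIf bN0); rewrite E lE; ring.
Qed.

End RationalExtensionConstants.

Section Extensions.
Variable L : diffFieldType.
Hypothesis ch : char0 L.
Hypothesis cc : closed_constants L.
Variable c : form1 L.
Hypothesis dc : d1 c = 0.

Let dexp (i : 'I_3) : {poly L} := c 0 i *: 'X.
Let dprim (i : 'I_3) : {poly L} := (c 0 i)%:P.

Let coef_dexp i p j : (pder dexp i p)`_j = der i p`_j + j%:R * c 0 i * p`_j.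
Proof.
rewrite /pder coefD coef_map /dexp -scalerAr coefZ coefMX /=; congr (_ + _).
case: j => [|j] /=; first by rewrite mulr0 !mul0r.
by rewrite coef_deriv -mulr_natr; ring.
Qed.

Let coef_dprim i p j : (pder dprim i p)`_j = der i p`_j + j.+1%:R * c 0 i * p`_j.+1.
Proof. by rewrite /pder coefD coef_map /dprim coefMC coef_deriv -mulr_natr /=; congr (_ + _); ring. Qed.

Let dexp_comm i j : pder dexp i (dexp j) = pder dexp j (dexp i).
Proof.
apply/polyP=> l; rewrite !coef_dexp !coefZ !coefX.
by case: (l == 1%N); rewrite /= ?mulr1 ?mulr0 ?raddf0 ?mulr0 // (closed_formP dc); ring.
Qed.

Let dprim_comm i j : pder dprim i (dprim j) = pder dprim j (dprim i).
Proof. by rewrite !pderC (closed_formP dc). Qed.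

(** If c = dg, a free generator t would make t - g a new constant, so [L] itself serves, as a finite
    step of degree one. Otherwise numerator and denominator of a constant of L(t) are themselves
    killed by the derivations, and a nonconstant polynomial with that property would exhibit c as
    exact. *)
Lemma primitive_extension : exists (M : diffExt L) (t : M),
  [/\ d0 t = lift1 M c, liouvillian_step (range (emb M)) [set: M]%classic &
      @constants M = (emb M @` @constants L)%classic].
Proof.
have [[g cE]|ng] := pselect (exists g, c = d0 g).
  have hid i (x : L) : der i ((idfun : {rmorphism L -> L}) x) = idfun (der i x) by [].
  exists (DiffExt hid), g; split=> /=.
  - by rewrite cE; apply/rowP=> i; rewrite !mxE.
  - apply: Or33; split=> //; exists 1%N, (fun _ => 1); split=> // x _.
    by exists (fun _ => x); rewrite big_ord1 mulr1; split=> // j; exists x.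
  - by apply/seteqP; split=> [x cx|_ [x cx <-] //]; exists x.
have [M [t [nt dt adj]]] := fraction_extension dprim_comm.
have he := @emb_der _ M.
exists M, t; split.
- by apply/rowP=> i; rewrite !mxE dt evC.
- apply: Or32; exists t, (lift1 M c); split=> //.
    by apply/form1_overP; exists c.
  by apply/rowP=> i; rewrite !mxE dt evC.
apply/seteqP; split=> [x cx|_ [y cy <-]]; last exact: constants_map.
have sdelta i : (size (dprim i) <= 2)%N by rewrite (leq_trans (size_polyC_leq1 _)).
have [a [b [bm b0 xE ab]]] := constant_darboux_pair (fun i y => he i y) nt dt sdelta adj cx.
(* The derivative of the monic [b] has coefficient 0 in the degree of [b], so the common factor is
   0. *)
have l0 i : pder dprim i a = 0 /\ pder dprim i b = 0.
  have [l [aE bE]] := ab i; suff l0 : l = 0 by rewrite aE bE l0 !scale0r.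
  have := coef_dprim i b (size b).-1; rewrite bE coefZ -lead_coefE (monicP bm) mulr1 der1 add0r.
  by rewrite nth_default ?mulr0 // leqSpred.
have small p : (forall i, pder dprim i p = 0) -> exists u, p = u%:P.
  move=> dp; case sp : (size p) => [|[|n]].
  - by exists 0; move/eqP: sp; rewrite size_poly_eq0 => /eqP ->.
  - by exists p`_0; apply: size1_polyC; rewrite sp.
  have pn0 : p`_n.+1 != 0 by rewrite -[n.+1]/(n.+2.-1) -sp -lead_coefE lead_coef_eq0 -size_poly_gt0 sp.
  (* The two top coefficients of a vanishing derivative read d p_(n+1) = 0 and d p_n = - (n + 1)
     p_(n+1) c, which integrates c. *)
  case: ng; exists (- (p`_n / (n.+1%:R * p`_n.+1))); apply/rowP=> i; rewrite mxE.
  have dpn : der i p`_n.+1 = 0.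
    have := coef_dprim i p n.+1; rewrite dp coef0 (nth_default _ (eq_leq sp)) mulr0 addr0.
    by move=> <-.
  have := coef_dprim i p n; rewrite dp coef0 => /esym/eqP; rewrite addr_eq0 => /eqP dpn'.
  rewrite raddfN /= der_div ?mulf_neq0 ?ch // derM der_nat dpn dpn'.
  by field; rewrite pn0 addrC natr1 ch.
have [u aE] := small a (fun i => (l0 i).1); have [v bE] := small b (fun i => (l0 i).2).
have xuv : x = emb M (u / v) by rewrite xE aE bE !evC fmorph_div.
exists (u / v) => // i; apply: (fmorph_inj (emb M)); rewrite -he rmorph0 -xuv; exact: cx.
Qed.

Let step_exp (M : diffExt L) (t : M) : t != 0 -> d0 t = t *: lift1 M c ->
  adjoin (range (emb M)) t = [set: M]%classic ->
  liouvillian_step (range (emb M)) [set: M]%classic.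
Proof.
move=> t0 dt adj; apply: Or31; exists t, (lift1 M c); split=> //.
by apply/form1_overP; exists c.
Qed.

(* When [n c = dlog g] a transcendental [t] would make [t ^+ n / g] a new
   constant; an irreducible factor of [X^n - g] is used instead. *)
Lemma exponential_extension : exists (M : diffExt L) (t : M),
  [/\ t != 0, d0 t = t *: lift1 M c,
      liouvillian_step (range (emb M)) [set: M]%classic &
      @constants M = (emb M @` @constants L)%classic].
Proof.
have [[n [g [n0 g0 gE]]]|nlog] :=
  pselect (exists n g, [/\ (0 < n)%N, g != 0 & dlog g = n%:R *: c]).
  have dg i : der i g = n%:R * c 0 i * g.
    by move/rowP: gE => /(_ i); rewrite !mxE => <-; field.
  pose h : {poly L} := 'X^n - g%:P.
  have sh : size h = n.+1 by apply: size_XnsubC.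
  have dh i : pder dexp i h = (n%:R * c 0 i) *: h.
    apply/polyP=> j; rewrite coef_dexp coefZ !coefB coefXn coefC.
    have [->|jn] := eqVneq j n; first by rewrite gtn_eqF //= subr0 der1 !mulr1 add0r.
    have [->|j0] := eqVneq j 0%N; last by rewrite /= subr0 raddf0 !mulr0 addr0.
    by rewrite /= !sub0r raddfN /= dg; ring.
  have [pi0 irr0 pi0h] : exists2 pi0, irreducible_poly pi0 & pi0 %| h.
    by apply: exists_irreducible; rewrite sh.
  pose pi := (lead_coef pi0)^-1 *: pi0.
  have lc0 : (lead_coef pi0)^-1 != 0 by rewrite invr_eq0 lead_coef_eq0 irredp_neq0.
  have irr : irreducible_poly pi.
    case: irr0 => s1 irr0; split; first by rewrite size_scale.
    by move=> q sq; rewrite dvdpZr // => /(irr0 _ sq) qp; rewrite eqp_sym (eqp_trans (eqp_scale _ lc0)) // eqp_sym.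
  have pim : pi \is monic.
    by apply/monicP; rewrite lead_coefZ mulVf // -invr_eq0.
  have pih : pi %| h by rewrite dvdpZl.
  have piX : ~~ (pi %| 'X^n).
    apply/negP => piX; have : pi %| g%:P.
      have -> : g%:P = 'X^n - h by rewrite /h opprB addrC subrK.
      exact: dvdp_sub.
    move/dvdp_leq; rewrite polyC_eq0 size_polyC g0 => /(_ isT).
    by rewrite leqNgt; case: irr => ->.
  (* The ideal of h is stable, and pi is a simple factor of h: a double one would divide h' = n
     X^(n-1), hence X^n, hence the nonzero constant g. *)
  have dpi i : pi %| pder dexp i pi.
    have /dvdpP [q hE] := pih.
    have : pi %| q * pder dexp i pi.
      have -> : q * pder dexp i pi = pder dexp i h - pder dexp i q * pi.
        by rewrite hE pderM addrC addKr.
      by rewrite dvdp_sub ?dvdp_mull // dh -mul_polyC dvdp_mull.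
    move=> /(irreducible_dvdM irr) /orP [/dvdpP [q1 qE]|//].
    case/negP: piX; have : pi %| h^`().
      by rewrite hE qE derivM; apply: dvdp_add; [|apply: dvdp_mulr]; rewrite dvdp_mull ?dvdpp.
    rewrite /h derivB derivC subr0 derivXn -scaler_nat dvdpZr ?char0_nat // => H.
    by rewrite -(prednK n0) exprSr dvdp_mulr.
  have [M [t [ev0 dt evs]]] := quotient_extension dexp_comm pim irr dpi.
  have he := @emb_der _ M.
  have dt' : d0 t = t *: lift1 M c.
    by apply/rowP=> i; rewrite !mxE dt evZ evX mulrC.
  have t0 : t != 0.
    apply: contraNneq piX => t0; rewrite -ev0 rmorphXn /= evX t0 expr0n.
    by rewrite gtn_eqF.
  have adj : adjoin (range (emb M)) t = [set: M]%classic.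
    apply/seteqP; split=> // x _; apply/adjoinP; have [q ->] := evs x.
    by exists q, 1; rewrite rmorph1 oner_neq0 divr1.
  exists M, t; split=> //; first exact: step_exp adj.
  apply/seteqP; split=> [x cx|_ [y cy <-]]; last exact: constants_map.
  (* An element q(t) of the quotient is a root of any polynomial that annihilates q modulo pi. *)
  apply: algebraic_constant => //.
  have [q xE] := evs x; have [P P0 dP] := annihilating_poly q (irredp_neq0 irr).
  by exists P => //; apply/eqP; rewrite xE -ev_comp ev0.
have [M [t [nt dt adj]]] := fraction_extension dexp_comm.
have he := @emb_der _ M.
have dt' : d0 t = t *: lift1 M c.
  by apply/rowP=> i; rewrite !mxE dt evZ evX mulrC.
have t0 : t != 0.
  by apply/eqP => t0; apply: nt; exists 'X; rewrite ?polyX_eq0 ?evX.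
exists M, t; split=> //; first exact: step_exp adj.
apply/seteqP; split=> [x cx|_ [y cy <-]]; last exact: constants_map.
have sdelta i : (size (dexp i) <= 2)%N.
  by rewrite (leq_trans (size_scale_leq _ _)) // size_polyX.
have [a [b [bm b0 xE ab]]] := constant_darboux_pair (fun i y => he i y) nt dt sdelta adj cx.
(* Nonzero coefficients of different degrees j < l would have a quotient with logarithmic
   differential (l - j) c, which is excluded. So [a] and [b] are monomials of one common degree, and
   their quotient lies in [L]. *)
have same p q j l : (forall i, exists u, pder dexp i p = u *: p /\ pder dexp i q = u *: q) ->
    p`_j != 0 -> q`_l != 0 -> (j < l)%N -> False.
  move=> pq pj ql jl; apply: nlog; exists (l - j)%N, (p`_j / q`_l).
  rewrite subn_gt0 jl mulf_neq0 ?invr_eq0 //; split=> //; apply/rowP=> i; rewrite !mxE.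
  have [u [pE qE]] := pq i.
  have := coef_dexp i p j; rewrite pE coefZ => /esym/(canRL (addrK _)) dpj.
  have := coef_dexp i q l; rewrite qE coefZ => /esym/(canRL (addrK _)) dql.
  rewrite der_div // dpj dql natrB; last exact: ltnW.
  by field; rewrite pj ql.
pose j := (size b).-1.
have bj : b`_j != 0 by rewrite -lead_coefE (monicP bm) oner_neq0.
have single p : (forall i, exists u, pder dexp i p = u *: p /\ pder dexp i b = u *: b) ->
    p = p`_j *: 'X^j.
  move=> pb; apply/polyP=> l; rewrite coefZ coefXn.
  have [->|lj] := eqVneq l j; first by rewrite mulr1.
  rewrite mulr0; apply/eqP; apply/negP => /negP pl.
  have := lj; rewrite neq_ltn => /orP [lj'|jl]; first exact: (same p b l j).
  apply: (same b p j l) => // i; have [u [? ?]] := pb i; by exists u.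
have aE := single a ab.
have bE : b = b`_j *: 'X^j.
  by apply: single => i; have [u [_ ?]] := ab i; exists u.
have xuv : x = emb M (a`_j / b`_j).
  rewrite xE {1}aE {1}bE !evZ rmorphXn /= evX fmorph_div; field.
  by rewrite ?expf_neq0 ?fmorph_eq0 ?bj ?andbT.
exists (a`_j / b`_j) => // i; apply: (fmorph_inj (emb M)); rewrite -he rmorph0 -xuv; exact: cx.
Qed.

End Extensions.

(** * Darboux multipliers in Liouvillian extensions *)

Local Open Scope classical_set_scope.

Section ImageSubfields.
Variables (k L : diffFieldType) (e : {rmorphism k -> L}).
Hypothesis he : forall i x, der i (e x) = e (der i x).

Lemma image_subfield (S : set k) : subfield S -> subfield (e @` S).
Proof.
move=> sS; split; first by exists 1; [exact: (subfield1 sS)|exact: rmorph1].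
  move=> _ _ [x Sx <-] [y Sy <-]; exists (x - y); last exact: rmorphB.
  exact: (subfieldB sS).
move=> _ _ [x Sx <-] [y Sy <-]; exists (x / y); last exact: fmorph_div.
exact: (subfield_div sS).
Qed.

Lemma image_diff_subfield (S : set k) : diff_subfield S -> diff_subfield (e @` S).
Proof.
move=> [sS dS]; split; first exact: image_subfield.
by move=> i _ [x Sx <-]; exists (der i x); [exact: dS|rewrite he].
Qed.

Lemma image_adjoin (S : set k) t : e @` adjoin S t = adjoin (e @` S) (e t).
Proof.
have sA := adjoin_subfield (e @` S) (e t).
apply/seteqP; split=> [_ [x Sx <-]|].
  pose B := [set y | adjoin (e @` S) (e t) (e y)].
  have sB : subfield B.
    split; first by rewrite /B /= rmorph1; exact: (subfield1 sA).
      by move=> y z By Bz; rewrite /B /= rmorphB; exact: (subfieldB sA).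
    by move=> y z By Bz; rewrite /B /= fmorph_div; exact: (subfield_div sA).
  apply: (adjoin_min sB _ _ Sx); last exact: adjoin_gen.
  by move=> y Sy; apply: adjoin_base; exists y.
apply: adjoin_min.
- exact: image_subfield (adjoin_subfield _ _).
- by move=> _ [y Sy <-]; exists y => //; apply: adjoin_base.
- by exists t => //; apply: adjoin_gen.
Qed.

Lemma image_liouvillian_step (S T : set k) :
  liouvillian_step S T -> liouvillian_step (e @` S) (e @` T).
Proof.
case=> [[t [a [-> t0 Sa ta]]]|[t [a [-> Sa ta]]]|[ST [n [b [Tb sb]]]]].
- apply: Or31; exists (e t), (map_mx e a); rewrite image_adjoin fmorph_eq0; split=> //.
    by move=> i; rewrite mxE; exists (a 0 i).
  by rewrite map_d0 // ta map_mxZ.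
- apply: Or32; exists (e t), (map_mx e a); rewrite image_adjoin; split=> //.
    by move=> i; rewrite mxE; exists (a 0 i).
  by rewrite map_d0 // ta.
- apply: Or33; split=> [_ [x Sx <-]|]; first by exists x => //; apply: ST.
  exists n, (e \o b); split=> [j|_ [x Tx <-]]; first by exists (b j).
  have [c [Sc ->]] := sb x Tx; exists (e \o c); split=> [j|]; first by exists (c j).
  by rewrite rmorph_sum; apply: eq_bigr => j _; rewrite rmorphM.
Qed.

End ImageSubfields.

Fact comp_ext_der (K : diffFieldType) (L : diffExt K) (M : diffExt L) i (x : K) :
  der i ((emb M \o emb L : {rmorphism K -> M}) x) = (emb M \o emb L) (der i x).
Proof. by rewrite /= !emb_der. Qed.

Definition comp_ext (K : diffFieldType) (L : diffExt K) (M : diffExt L) : diffExt K :=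
  DiffExt (@comp_ext_der K L M).

Lemma setT_diff_subfield (L : diffFieldType) : diff_subfield [set: L].
Proof. by []. Qed.

Lemma liouvillian_comp (K : diffFieldType) (L : diffExt K) (M : diffExt L) :
  liouvillian L -> liouvillian_step (range (emb M)) [set: M] ->
  @constants M = emb M @` @constants L -> liouvillian (comp_ext M).
Proof.
move=> [cL [m [F [F0 Fm dF sF]]]] step cM; split.
  by rewrite cM cL image_comp.
(* The field of index [m] is the image of the whole of [L], that is, the range from which the new
   step starts. *)
exists m.+1, (fun i => if (i <= m)%N then emb M @` F i else [set: M]); split.
- by rewrite leq0n F0 image_comp.
- by rewrite ltnn.
- move=> i _; case: ifP => [im|_]; last exact: setT_diff_subfield.
  by apply: image_diff_subfield; [exact: emb_der|exact: dF].
- move=> i; rewrite ltnS => im; rewrite im.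
  have [im'|mi] := ltnP i m.
    by apply: image_liouvillian_step; [exact: emb_der|exact: sF].
  have -> : i = m by apply/eqP; rewrite eqn_leq im mi.
  by rewrite Fm.
Qed.

Fact id_ext_der (K : diffFieldType) i (x : K) :
  der i ((idfun : {rmorphism K -> K}) x) = idfun (der i x).
Proof. by []. Qed.

Definition id_ext (K : diffFieldType) : diffExt K := DiffExt (@id_ext_der K).

Lemma liouvillian_id (K : diffFieldType) : liouvillian (id_ext K).
Proof.
split; first by apply/seteqP; split=> [x cx|_ [x cx <-] //]; exists x.
exists 0%N, (fun _ => [set: K]); split=> //.
by apply/seteqP; split=> // x _; exists x.
Qed.

Lemma lift1_comp (K : diffFieldType) (L : diffExt K) (M : diffExt L) (a : form1 K) :
  lift1 (comp_ext M) a = lift1 M (lift1 L a).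
Proof. by apply/rowP=> i; rewrite !mxE. Qed.

Section Construction.
Variable K : diffFieldType.
Hypothesis chK : char0 K.
Hypothesis ccK : closed_constants K.

Let ch (L : diffExt K) : char0 L := char0_codomain (emb L) chK.
Let cc (L : diffExt K) : liouvillian L -> closed_constants L.
Proof. by move=> [cL _]; apply: closed_constants_ext cL ccK. Qed.

Lemma liouvillian_exponentials n (a : nat -> form1 K) : (forall j, d1 (a j) = 0) ->
  exists (L : diffExt K) (P : nat -> L), liouvillian L /\
    forall j, (j < n)%N -> P j != 0 /\ dlog (P j) = lift1 L (a j).
Proof.
move=> ca; elim: n => [|n [L [P [liL hP]]]].
  by exists (id_ext K), (fun _ => 1); split=> //; apply: liouvillian_id.
have caL : d1 (lift1 L (a n)) = 0.
  by rewrite /lift1 map_d1 ?ca ?map_mx0 //; apply: emb_der.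
have [M [t [t0 dt step cM]]] := exponential_extension (ch L) (cc liL) caL.
exists (comp_ext M), (fun j => if j == n then t else emb M (P j)).
split; first exact: liouvillian_comp.
move=> j; rewrite ltnS leq_eqVlt lift1_comp; case: eqP => [->|_] /=.
  by move=> _; split=> //; rewrite /dlog dt scalerA mulVf // scale1r.
move=> /hP [P0 dP]; rewrite fmorph_eq0 P0; split=> //.
by rewrite map_dlog ?dP //; apply: emb_der.
Qed.

Lemma liouvillian_primitive (L : diffExt K) (a : form1 L) : liouvillian L -> d1 a = 0 ->
  exists (M : diffExt L) (t : M), liouvillian (comp_ext M) /\ d0 t = lift1 M a.
Proof.
move=> liL ca; have [M [t [dt step cM]]] := primitive_extension (ch L) ca.
by exists M, t; split=> //; apply: liouvillian_comp.
Qed.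

End Construction.

Section Darboux.
Variable C : closedFieldType.
Hypothesis chC : char0 C.
Local Notation K := (ratfun C).

Lemma darboux_function_neq0 (L : diffExt K) (m : L) : darboux_function m -> m != 0.
Proof.
move=> [f [g [n [fs [a [E [P [_ [E0 _] hP ->]]]]]]]].
by rewrite mulf_neq0 //; apply/prodf_neq0 => j _; apply: (hP j).1.
Qed.

Lemma darboux_function_comp (L : diffExt K) (M : diffExt L) (m : L) :
  darboux_function m -> darboux_function (emb M m : comp_ext M).
Proof.
move=> [f [g [n [fs [a [E [P [f0 [E0 dE] hP mE]]]]]]]].
have hM := @emb_der _ M.
exists f, g, n, fs, a, (emb M E), (fun j => emb M (P j)); split=> //.
- by rewrite fmorph_eq0; split=> //; rewrite lift1_comp -dE [LHS]map_dlog.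
- move=> j; have [P0 dP] := hP j; rewrite fmorph_eq0; split=> //.
  by rewrite lift1_comp -dP [LHS]map_dlog.
- by rewrite mE rmorphM rmorph_prod.
Qed.

Lemma darboux_integral (a : form1 K) : d1 a = 0 -> exists (L : diffExt K) (m : L),
  [/\ liouvillian L, darboux_function m & dlog m = lift1 L a].
Proof.
move=> /(closed_form_darboux chC) [f [g [n [fs [c [f0 fs0 aE]]]]]].
(* Index 0 is kept for exp(g/f) and index j + 1 for the power of f_j; past the range the form is 0,
   which is closed too. *)
pose b' (j : nat) : form1 K :=
  if insub j is Some i then of_cst (c i) *: dlog (of_poly (fs i)) else 0.
pose b (j : nat) : form1 K := if j is j'.+1 then b' j' else d0 (of_poly g / of_poly f).
have bE (j : 'I_n) : b' j = of_cst (c j) *: dlog (of_poly (fs j)) by rewrite /b' valK.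
have cb j : d1 (b j) = 0.
  case: j => [|j]; first exact: d1_d0.
  rewrite /b /b'; case: (insub j) => [i|]; last by apply/rowP=> i; rewrite !mxE !raddf0 ?addr0.
  rewrite d1Z_const ?d1_dlog ?scaler0 //.
  by rewrite constants_ratfun //; exists (c i).
have [L [P [liL hP]]] := liouvillian_exponentials
  (char0_ratfun chC) (closed_constants_ratfun chC) n.+1 cb.
have [P0 dP0] := hP 0%N isT.
have hPS (j : 'I_n) : P j.+1 != 0 /\
    dlog (P j.+1) = lift1 L (of_cst (c j) *: dlog (of_poly (fs j))).
  by rewrite -bE; exact: hP j.+1 (ltn_ord j).
exists L, (P 0%N * \prod_(j < n) P j.+1); split=> //.
  by exists f, g, n, fs, c, (P 0%N), (fun j : 'I_n => P j.+1); split.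
rewrite dlogM //; last by apply/prodf_neq0 => j _; apply: (hPS j).1.
rewrite dlog_prod ?dP0 /=; last by move=> j; apply: (hPS j).1.
rewrite aE /lift1 map_mxD raddf_sum /=; congr (_ + _).
by apply: eq_bigr => j _; apply: (hPS j).2.
Qed.

(** For dlog m = alpha, d(omega/m) = (alpha - dlog m) /\ omega/m = 0, so a primitive phi can be
    adjoined; it is not constant because omega/m is nonzero. *)
Lemma caseI_darboux (Omega : form2 K) : caseI Omega ->
  exists omega alpha : form1 K,
     [/\ omega != 0, wedge12 omega Omega = 0,
         wedge11 alpha omega = d1 omega, d1 alpha = 0 &
         exists (L : diffExt K) (m phi : L),
           [/\ liouvillian L,
               darboux_function m /\ dlog m = lift1 L alpha,
               d1 (m^-1 *: lift1 L omega) = 0,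
               d0 phi = m^-1 *: lift1 L omega &
               first_integral Omega phi]].
Proof.
move=> [o [a [o0 oO ao ca]]]; exists o, a; split=> //.
have [L [m [liL dm ma]]] := darboux_integral ca.
have m0 := darboux_function_neq0 dm.
have cl : d1 (m^-1 *: lift1 L o) = 0.
  have hL := @emb_der _ L; rewrite d1Z /lift1 map_d1 // -ao -map_wedge11 -/(lift1 L a) -ma.
  by apply/rowP=> i; rewrite !mxE !derV; field.
have [M [t [liM dt]]] := liouvillian_primitive (char0_ratfun chC) liL cl.
have hM := @emb_der _ M.
have mE : (emb M m)^-1 *: lift1 (comp_ext M) o = lift1 M (m^-1 *: lift1 L o).
  by rewrite lift1_comp /lift1 map_mxZ fmorphV.
exists (comp_ext M), (emb M m), t; split=> //.
- split; first exact: darboux_function_comp.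
  by rewrite lift1_comp -ma [LHS]map_dlog.
- by rewrite mE [LHS]map_d1 // cl map_mx0.
- by rewrite mE.
have em0 : (emb M m)^-1 != 0 by rewrite invr_eq0 fmorph_eq0.
have dt' : d0 t = (emb M m)^-1 *: lift1 (comp_ext M) o by rewrite mE.
split.
  move=> ct; move: o0; rewrite -(inj_eq (@map_row_inj _ _ (emb (comp_ext M)) 3)) map_mx0.
  rewrite -/(lift1 _ o); move/eqP; apply; apply: (scalerI em0).
  by rewrite -dt' scaler0; apply/rowP=> i; rewrite !mxE; apply: ct.
rewrite [d0 t]dt' wedge12Zl.
by rewrite /lift2 /lift1 [wedge12 _ _]map_wedge12 oO rmorph0 mulr0.
Qed.

(** For dlog m = beta, d(Omega/m) = (beta - dlog m) /\ Omega/m = 0. *)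
Lemma caseII_darboux (Omega : form2 K) : caseII Omega ->
  exists beta : form1 K,
     [/\ d2 Omega = wedge12 beta Omega, d1 beta = 0 &
         exists (L : diffExt K) (m : L),
           [/\ liouvillian L,
               darboux_function m /\ dlog m = lift1 L beta &
               d2 (m^-1 *: lift2 L Omega) = 0]].
Proof.
move=> [b [db cb]]; exists b; split=> //.
have [L [m [liL dm mb]]] := darboux_integral cb.
have m0 := darboux_function_neq0 dm; have hL := @emb_der _ L.
exists L, m; split=> //.
rewrite d2Z /lift2 map_d2 // db -map_wedge12 -/(lift1 L b) -mb.
have -> : d0 m^-1 = - m^-1 *: dlog m by apply/rowP=> i; rewrite !mxE derV; field.
by rewrite wedge12Zl mulNr addNr.
Qed.

End Darboux.

Lemma char0_complex (F : realType) : char0 (complex F).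
Proof. by move=> n; rewrite Num.Theory.pnatr_eq0. Qed.

Theorem theorem4 (F : realType) (P Q R : ratfun (complex F)) :
  let Omega := mk_form2 P Q R in
  has_liouvillian_first_integral Omega ->
  (exists omega alpha : form1 (ratfun (complex F)),
     [/\ omega != 0, wedge12 omega Omega = 0,
         wedge11 alpha omega = d1 omega, d1 alpha = 0 &
         exists (L : diffExt (ratfun (complex F))) (m phi : L),
           [/\ liouvillian L,
               darboux_function m /\ dlog m = lift1 L alpha,
               d1 (m^-1 *: lift1 L omega) = 0,
               d0 phi = m^-1 *: lift1 L omega &
               first_integral Omega phi]])
  \/
  (exists beta : form1 (ratfun (complex F)),
     [/\ d2 Omega = wedge12 beta Omega, d1 beta = 0 &
         exists (L : diffExt (ratfun (complex F))) (m : L),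
           [/\ liouvillian L,
               darboux_function m /\ dlog m = lift1 L beta &
               d2 (m^-1 *: lift2 L Omega) = 0]]).
Proof.
move=> Omega; have ch := @char0_complex F.
move=> /(liouvillian_first_integral_cases (char0_ratfun ch)) [/(caseI_darboux ch)|/(caseII_darboux ch)].
  by left.
by right.
Qed.
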